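(* Let $(X, K)$ be a nonempty symmetric space with similarities. (i) We have $$D_{\max}(X) = \sup_Y |Y|,$$ where the supremum is over the nonempty closed subsets $Y$ of $X$ admitting a positive weight measure. (ii) A probability measure $\mu$ on $X$ is maximising if and only if it is equal to $\widehat{\nu}$ for some positive weight measure $\nu$ on some subset $Y$ attaining the supremum in (i) (that is, some nonempty closed $Y \subseteq X$ admitting a positive weight measure and satisfying $|Y| = D_{\max}(X)$). In that case, $D_{\max}(X) = |\operatorname{supp}\mu|$.
   Context: A measure means a positive Radon measure. A (compact Hausdorff) space with similarities $(X,K)$ is a compact Hausdorff space $X$ together with a continuous function $K : X \times X \to [0,\infty)$ (a similarity kernel) satisfying $K(x,x) > 0$ for all $x \in X$. It is symmetric if $K(x,y) = K(y,x)$ for all $x,y \in X$. $P(X)$ denotes the set of (Radon) probability measures on $X$, and $M(X)$ the set of finite signed (Radon) measures on $X$. For $\mu \in M(X)$, the typicality function $K\mu : X \to \mathbb{R}$ is $(K\mu)(x) = \int_X K(x,y)\, d\mu(y)$. For $\mu \in P(X)$, $K\mu$ is continuous and strictly positive on the support $\operatorname{supp}\mu$ (the smallest closed set whose complement is $\mu$-null). For $q \in [-\infty,\infty]$, the diversity of order $q$ of $\mu \in P(X)$ is $D_q^K(\mu) \in (0,\infty)$ defined by $D_q^K(\mu) = \left( \int_X (K\mu)^{q-1}\, d\mu \right)^{1/(1-q)}$ for $q \in \mathbb{R}\setminus\{1\}$; $D_1^K(\mu) = \exp\left(-\int_X \log(K\mu)\, d\mu\right)$; $D_\infty^K(\mu)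 = 1/\operatorname{ess\,sup}_\mu K\mu$; $D_{-\infty}^K(\mu) = 1/\operatorname{ess\,inf}_\mu K\mu$ (the integrands being defined on $\operatorname{supp}\mu$, hence $\mu$-almost everywhere). A probability measure $\mu$ on $X$ is maximising if for every $q \in [0,\infty]$ it maximises $D_q^K$ over $P(X)$. For nonempty symmetric $(X,K)$, the maximum diversity is $D_{\max}(X) = \sup_{\mu \in P(X)} D_q^K(\mu)$, whose value is independent of the choice of $q \in [0,\infty]$. A closed subset $Y \subseteq X$ is regarded as a space with similarities by restricting $K$. A weight measure on a space with similarities $(Y,K)$ is a signed measure $\nu \in M(Y)$ such that $(K\nu)(y) = 1$ for all $y \in Y$; a positive weight measure is a weight measure that is a positive measure. If $(Y,K)$ is symmetric and admits a weight measure, its magnitude is $|Y| = \nu(Y)$ for any weight measure $\nu$ on $Y$ (this is independent of $\nu$). For a nonzero measure $\nu$ on a closed subset $Y \subseteq X$, $\widehat{\nu}$ is the probability measure on $X$ given by $\widehat{\nu}(U) = \nu(U \cap Y)/\nu(Y)$ for Borel $U \subseteq X$. *)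

(* Defs.v *)
From HB Require Import structures.
From mathcomp Require Import all_boot all_order all_algebra.
From mathcomp Require Import all_classical all_reals all_analysis.
From mathcomp Require Import ess_sup_inf.

Set Implicit Arguments.
Unset Strict Implicit.
Unset Printing Implicit Defensive.

Import Order.TTheory GRing.Theory Num.Theory.
Import numFieldNormedType.Exports.

Local Open Scope classical_set_scope.
Local Open Scope ring_scope.

(* The library's measurable types are pointed, so nonempty spaces are taken
   to be pointed; no definition below depends on the chosen point. *)
Definition borel (X : ptopologicalType) := g_sigma_algebraType (@open X).

(* Inner regularity by compact sets. It is only applied to finite Borel
   measures, which are therefore finite on compact sets. *)
Definition radon (R : realType) (X : ptopologicalType)
    (mu : set (borel X) -> \bar R) : Prop :=
  forall A : set (borel X), measurable A ->
    mu A = ereal_sup [set mu C | C in [set C : set X | compact C /\ C `<=` A]].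

Lemma hahn_pair_exists (R : realType) (X : ptopologicalType)
    (nu : {charge set (borel X) -> \bar R}) :
  exists PN : set (borel X) * set (borel X), hahn_decomposition nu PN.1 PN.2.
Proof. by have [P [N nuPN]] := Hahn_decomposition nu; exists (P, N). Qed.

(* Hahn decompositions are unique up to null sets, so the positive and negative
   parts defined from a chosen one do not depend on it. *)
Definition hahn_of (R : realType) (X : ptopologicalType)
    (nu : {charge set (borel X) -> \bar R}) :=
  svalP (cid (hahn_pair_exists nu)).

Definition radon_charge (R : realType) (X : ptopologicalType)
    (nu : {charge set (borel X) -> \bar R}) : Prop :=
  radon (charge_variation (hahn_of nu)).

Definition similarity_kernel (R : realType) (X : ptopologicalType)
    (K : X -> X -> R) : Prop :=
  [/\ continuous (fun p : X * X => K p.1 p.2),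
      forall x y, 0 <= K x y
    & forall x, 0 < K x x].

Definition space_with_similarities (R : realType) (X : ptopologicalType)
    (K : X -> X -> R) : Prop :=
  [/\ compact [set: X], hausdorff_space X & similarity_kernel K].

Definition symmetric_kernel (R : realType) (X : Type) (K : X -> X -> R) : Prop :=
  forall x y, K x y = K y x.

Definition typicality (R : realType) (X : ptopologicalType) (K : X -> X -> R)
    (mu : {measure set (borel X) -> \bar R}) (x : X) : R :=
  \int[mu]_(y in [set: borel X]) K x y.

Definition charge_typicality (R : realType) (X : ptopologicalType)
    (K : X -> X -> R) (nu : {charge set (borel X) -> \bar R}) (x : X) : R :=
  typicality K (jordan_pos (hahn_of nu)) x -
  typicality K (jordan_neg (hahn_of nu)) x.

Definition supp (R : realType) (X : ptopologicalType)
    (mu : set (borel X) -> \bar R) : set X :=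
  \bigcap_(C in [set C : set X | closed C /\ mu (~` C) = 0%E]) C.

Definition diversity (R : realType) (X : ptopologicalType) (K : X -> X -> R)
    (q : \bar R) (mu : probability (borel X) R) : R :=
  match q with
  | r%:E =>
      if r == 1 then
        expR (- \int[mu]_(x in supp mu) ln (typicality K mu x))
      else
        (\int[mu]_(x in supp mu) (typicality K mu x `^ (r - 1)))
          `^ (1 / (1 - r))
  | +oo%E => (fine (ess_sup mu (fun x => (typicality K mu x)%:E)))^-1
  | -oo%E => (fine (ess_inf mu (fun x => (typicality K mu x)%:E)))^-1
  end.

Definition maximising (R : realType) (X : ptopologicalType) (K : X -> X -> R)
    (mu : probability (borel X) R) : Prop :=
  radon mu /\
  forall q : \bar R, (0 <= q)%E ->
    forall mu' : probability (borel X) R, radon mu' ->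
      diversity K q mu' <= diversity K q mu.

Definition max_diversity (R : realType) (X : ptopologicalType)
    (K : X -> X -> R) (q : \bar R) : \bar R :=
  ereal_sup [set (diversity K q mu)%:E | mu in
              [set mu : probability (borel X) R | radon mu]].

Definition weight_measure (R : realType) (X : ptopologicalType)
    (K : X -> X -> R) (nu : {charge set (borel X) -> \bar R}) : Prop :=
  radon_charge nu /\ forall x, charge_typicality K nu x = 1.

Definition positive_weight_measure (R : realType) (X : ptopologicalType)
    (K : X -> X -> R) (nu : {charge set (borel X) -> \bar R}) : Prop :=
  weight_measure K nu /\
  forall A : set (borel X), measurable A -> (0 <= nu A)%E.

Definition admits_weight_measure (R : realType) (X : ptopologicalType)
    (K : X -> X -> R) : Prop :=
  exists nu : {charge set (borel X) -> \bar R}, weight_measure K nu.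

Definition admits_positive_weight_measure (R : realType) (X : ptopologicalType)
    (K : X -> X -> R) : Prop :=
  exists nu : {charge set (borel X) -> \bar R}, positive_weight_measure K nu.

(* The total mass of some weight measure; for symmetric K it is the same for
   all of them. Meaningful only if there is one. *)
Definition magnitude (R : realType) (X : ptopologicalType)
    (K : X -> X -> R) : R :=
  get [set m : R | exists nu : {charge set (borel X) -> \bar R},
         weight_measure K nu /\ m = fine (nu [set: borel X])].

(* A nonempty subset of X as a space in its own right, with the subspace
   topology. *)
Definition subsp (X : ptopologicalType) (Y : set X) (Y0 : Y !=set0) : Type :=
  set_type Y.

Definition subsp_point (X : ptopologicalType) (Y : set X) (Y0 : Y !=set0) :
    subsp Y0 :=
  SigSub (mem_set (svalP (cid Y0))).

HB.instance Definition _ (X : ptopologicalType) (Y : set X) (Y0 : Y !=set0) :=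
  Topological.copy (subsp Y0) (set_type Y).
HB.instance Definition _ (X : ptopologicalType) (Y : set X) (Y0 : Y !=set0) :=
  isPointed.Build (subsp Y0) (subsp_point Y0).

Definition subsp_val (X : ptopologicalType) (Y : set X) (Y0 : Y !=set0) :
  subsp Y0 -> X := @set_val X Y.

Definition restrict_kernel (R : realType) (X : ptopologicalType)
    (K : X -> X -> R) (Y : set X) (Y0 : Y !=set0) :
    subsp Y0 -> subsp Y0 -> R :=
  fun y y' => K (subsp_val y) (subsp_val y').

(* The normalised extension by zero to X of a measure on Y. *)
Definition hat (R : realType) (X : ptopologicalType) (Y : set X)
    (Y0 : Y !=set0) (nu : {charge set (borel (subsp Y0)) -> \bar R})
    (U : set (borel X)) : \bar R :=
  (nu (@subsp_val X Y Y0 @^-1` U) *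
   ((fine (nu [set: borel (subsp Y0)]))^-1)%:E)%E.

Definition sup_magnitude (R : realType) (X : ptopologicalType)
    (K : X -> X -> R) : \bar R :=
  ereal_sup [set m : \bar R | exists (Y : set X) (Y0 : Y !=set0),
    [/\ closed Y,
        admits_positive_weight_measure (restrict_kernel K (Y0 := Y0))
      & m = (magnitude (restrict_kernel K (Y0 := Y0)))%:E]].

(* Main.v *)
Require Import Defs.
From HB Require Import structures.
From mathcomp Require Import all_boot all_order all_algebra.
From mathcomp Require Import all_classical all_reals all_analysis.
From mathcomp Require Import measurable_realfun ess_sup_inf.
From mathcomp Require Import ring lra.

(* Write t = K mu. Tangent-line inequalities bound every diversity of order
   q >= 0 by the one of order 0, the integral of 1/t. On a finite space,
   [x y <= (x^2 + y^2) / 2] and symmetry of K show that reweighting mu by 1/t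
   gives a measure whose diversity of order 2 is at least the diversity of
   order 0 of mu; hence a minimiser of the quadratic form of K has equal
   diversities of orders 0 and 2, which forces its typicality to be constant on
   its support. Dividing such a balanced measure by the constant gives a
   positive weight measure whose mass is the diversity. For compact X, a fine
   finite Borel partition reduces the bound to finite subspaces, so the supremum
   over P(X) is approached by finitely supported balanced measures and no weak-*
   compactness is needed. A maximising measure attains the same value at the
   orders 0 and +oo, so it is balanced as well. *)

Set Implicit Arguments.
Unset Strict Implicit.
Unset Printing Implicit Defensive.

Import Order.TTheory GRing.Theory Num.Theory.
Import numFieldNormedType.Exports.

Local Open Scope classical_set_scope.
Local Open Scope ring_scope.

(** * Finite spaces *)

Lemma continuous_sum (R : realType) (T : topologicalType) n
    (F : 'I_n -> T -> R) :
  (forall i, continuous (F i)) -> continuous (fun x => \sum_i F i x).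
Proof. by move=> Fc; apply: continuous_big => //; exact: add_continuous. Qed.

Section finite_spaces.
Context (R : realType) (n : nat) (A : 'I_n -> 'I_n -> R).
Hypotheses (A_sym : forall i j, A i j = A j i) (A_ge0 : forall i j, 0 <= A i j).
Hypothesis A_diag : forall i, 0 < A i i.
Implicit Types p w : 'I_n -> R.

Definition prob_vec p := (forall i, 0 <= p i) /\ \sum_i p i = 1.
Definition typ_vec p i := \sum_j A i j * p j.
(** The reciprocal of the diversity of order 2 of p; the diversity of order 0 appears below as the
    sum of the [p i / typ_vec p i]. *)
Definition quad p := \sum_i p i * typ_vec p i.

Lemma typ_vec_gt0 p i : (forall j, 0 <= p j) -> 0 < p i -> 0 < typ_vec p i.
Proof.
move=> p0 pi0; rewrite /typ_vec (bigD1 i)//= ltr_pwDl//.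
  by rewrite mulr_gt0.
by rewrite sumr_ge0// => j _; rewrite mulr_ge0.
Qed.

Lemma prob_vec_gt0 p : prob_vec p -> exists i, 0 < p i.
Proof.
move=> [p0 p1]; apply: contrapT => /forallNP np.
have : \sum_i p i = 0.
  apply: big1 => i _; apply/eqP; rewrite eq_le p0 andbT leNgt.
  exact/negP/np.
by rewrite p1 => /eqP; rewrite oner_eq0.
Qed.

Lemma quad_gt0 p : prob_vec p -> 0 < quad p.
Proof.
move=> /[dup] /prob_vec_gt0[i pi0] [p0 _].
rewrite /quad (bigD1 i)//= ltr_pwDl//.
  by rewrite mulr_gt0 ?typ_vec_gt0.
rewrite sumr_ge0// => j _; rewrite mulr_ge0// sumr_ge0// => k _.
by rewrite mulr_ge0.
Qed.

Lemma harmonic_gt0 p : prob_vec p -> 0 < \sum_i p i / typ_vec p i.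
Proof.
move=> /[dup] /prob_vec_gt0[i pi0] [p0 _].
rewrite (bigD1 i)//= ltr_pwDl//.
  by rewrite divr_gt0 ?typ_vec_gt0.
rewrite sumr_ge0// => j _; rewrite divr_ge0// sumr_ge0// => k _.
by rewrite mulr_ge0.
Qed.

(* AM-GM on [x y <= (x^2 + y^2) / 2] and the symmetry of A: the diversity of
   order 0 of p is at most that of order 2 of the reweighting of p by 1/(Ap). *)
Lemma quad_reweight p : prob_vec p ->
  exists2 p', prob_vec p' & quad p' <= (\sum_i p i / typ_vec p i)^-1.
Proof.
move=> pp; have D0 := harmonic_gt0 pp; have [p0 _] := pp.
set D := \sum_i _ in D0 *.
pose g i := (typ_vec p i)^-1.
have g0 i : 0 <= g i.
  by rewrite invr_ge0 sumr_ge0// => k _; rewrite mulr_ge0.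
exists (fun i => p i * g i / D).
  split; first by move=> i; rewrite !mulr_ge0// invr_ge0 ltW.
  by rewrite -mulr_suml divff// gt_eqF.
have -> : quad (fun i => p i * g i / D) =
    (\sum_i \sum_j A i j * p i * p j * (g i * g j)) / D ^+ 2.
  rewrite /quad mulr_suml; apply: eq_bigr => i _.
  rewrite mulr_suml mulr_sumr; apply: eq_bigr => j _.
  by field; rewrite gt_eqF.
rewrite ler_pdivrMr ?exprn_gt0// expr2 mulrA mulVf ?gt_eqF// mul1r.
pose S := \sum_i \sum_j A i j * p i * p j * g i ^+ 2.
(* Where [typ_vec p i] vanishes its inverse is 0 by convention, so [g i * typ_vec p i] is 0 or 1;
   hence only an inequality. *)
have SD : S <= D.
  apply: ler_sum => i _; rewrite -/(g i).
  have -> : \sum_j A i j * p i * p j * g i ^+ 2 = p i * g i * (g i * typ_vec p i).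
    rewrite /typ_vec !mulr_sumr; apply: eq_bigr => j _; ring.
  rewrite ler_piMr// ?mulr_ge0// /g.
  by have [->|h] := eqVneq (typ_vec p i) 0; rewrite ?mulr0// mulVf.
apply: le_trans SD.
have -> : S = (S + \sum_i \sum_j A i j * p i * p j * g j ^+ 2) / 2.
  suff -> : \sum_i \sum_j A i j * p i * p j * g j ^+ 2 = S.
    by field.
  rewrite exchange_big/=; apply: eq_bigr => i _; apply: eq_bigr => j _.
  by rewrite A_sym; ring.
rewrite -big_split/= mulr_suml; apply: ler_sum => i _.
rewrite -big_split/= mulr_suml; apply: ler_sum => j _.
rewrite -mulrDr -[leRHS]mulrA ler_wpM2l ?mulr_ge0//.
by have := sqr_ge0 (g i - g j); lra.
Qed.

(** Extreme value theorem on the simplex, a closed subset of the compact unit cube of row vectors;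
    [p0] witnesses that the simplex is nonempty. *)
Lemma quad_min p0 : prob_vec p0 ->
  exists2 w, prob_vec w & forall p, prob_vec p -> quad w <= quad p.
Proof.
move=> pp0.
pose cube := [set v : 'rV[R]_n | forall i, `[0 : R, 1]%classic (v ord0 i)].
pose simplex := cube `&` [set v : 'rV[R]_n | \sum_i v ord0 i = 1].
have coordc i : continuous (fun v : 'rV[R]_n => v ord0 i).
  exact: (@coord_continuous R 1 n ord0 i).
have cs : compact simplex.
  apply: compact_closedI.
    apply: (@rV_compact R n (fun=> `[0, 1]%classic)) => _.
    exact: segment_compact.
  apply: (@preimage_closed _ _ _ [set x : R | x = 1]); last exact: closed_eq.
  by move=> v _; exact: continuous_sum.
pose q (v : 'rV[R]_n) := quad (fun i => v ord0 i).
have cq : {within simplex, continuous q}.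
  apply: continuous_subspaceT; apply: continuous_sum => i v.
  apply: continuousM; first exact: coordc.
  apply: continuous_sum => j u.
  by apply: continuousM; [exact: cst_continuous|exact: coordc].
have toS p : prob_vec p -> simplex (\row_i p i).
  move=> [ge0 s1]; split => /=.
    move=> i /=; rewrite mxE in_itv/= ge0/= -s1 (bigD1 i)//= lerDl.
    by rewrite sumr_ge0.
  by rewrite -[RHS]s1; apply: eq_bigr => i _; rewrite mxE.
have q_row p : q (\row_i p i) = quad p.
  by congr quad; apply/funext => i; rewrite mxE.
have [//|v vS vmin] := compact_EVT_min _ cs cq.
  by exists (\row_i p0 i); exact: toS.
exists (fun i => v ord0 i).
  move/set_mem: vS => [vc vs]; split => // i.
  by have := vc i; rewrite /= in_itv/= => /andP[].
by move=> p /toS /mem_set /vmin; rewrite q_row.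
Qed.

(* The minimiser w of the quadratic form satisfies
   [\sum_i w_i / (Aw)_i <= 1 / c] and [\sum_i w_i (Aw)_i = c], so the
   sum of [w_i ((Aw)_i / c + c / (Aw)_i - 2) >= 0] vanishes termwise. *)
Lemma balanced_vec p : prob_vec p ->
  exists w c, [/\ prob_vec w, 0 < c,
    forall i, 0 < w i -> typ_vec w i = c & \sum_i p i / typ_vec p i <= c^-1].
Proof.
move=> pp; have [w ww wmin] := quad_min pp.
have harm p' : prob_vec p' -> \sum_i p' i / typ_vec p' i <= (quad w)^-1.
  move=> pp'; have [v vv qv] := quad_reweight pp'.
  rewrite -[leLHS]invrK lef_pV2 ?posrE ?quad_gt0// ?invr_gt0 ?harmonic_gt0//.
  by rewrite (le_trans _ qv)// wmin.
have c0 := quad_gt0 ww; exists w, (quad w); split => //; last exact: harm.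
have := harm _ ww; set c := quad w in c0 * => hw.
have [w0 w1] := ww.
have term0 i : 0 <= w i * (typ_vec w i / c + c / typ_vec w i - 2).
  have [->|wi] := eqVneq (w i) 0; first by rewrite mul0r.
  have t0 : 0 < typ_vec w i by rewrite typ_vec_gt0// lt_neqAle eq_sym wi w0.
  rewrite mulr_ge0//.
  rewrite [leRHS](_ : _ = (typ_vec w i - c) ^+ 2 / (typ_vec w i * c)).
    by rewrite divr_ge0 ?sqr_ge0 ?mulr_ge0 ?ltW.
  by field; rewrite !gt_eqF.
have : \sum_i w i * (typ_vec w i / c + c / typ_vec w i - 2) <= 0.
  under eq_bigr do rewrite mulrDr mulrDr mulrA [w _ * (c / _)]mulrCA.
  rewrite !big_split/= -mulr_suml -mulr_sumr -mulr_suml w1 mul1r.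
  rewrite [X in X / c](_ : _ = c)// divff ?gt_eqF//.
  by move: hw; rewrite -(ler_pM2l c0) divff ?gt_eqF//; lra.
move=> sum_le0 i wi.
have /eqP : w i * (typ_vec w i / c + c / typ_vec w i - 2) == 0.
  rewrite eq_le term0 andbT (le_trans _ sum_le0)// (bigD1 i)//= lerDl.
  exact: sumr_ge0.
have t0 := typ_vec_gt0 w0 wi.
move=> /eqP; rewrite mulf_eq0 gt_eqF//= => /eqP.
rewrite (_ : _ - 2 = (typ_vec w i - c) ^+ 2 / (typ_vec w i * c)); last first.
  by field; rewrite !gt_eqF.
have tc0 : 0 < (typ_vec w i * c)^-1 by rewrite invr_gt0 mulr_gt0.
move=> /eqP; rewrite mulf_eq0 (gt_eqF tc0) orbF.
by rewrite sqrf_eq0 subr_eq0 => /eqP.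
Qed.

End finite_spaces.

(** * Borel sets and integration *)

Section borel_sets.
Context (R : realType) (X : ptopologicalType).

Lemma open_measurable_borel (A : set X) :
  open A -> measurable (A : set (borel X)).
Proof. exact: sub_sigma_algebra. Qed.

Lemma closed_measurable_borel (A : set X) :
  closed A -> measurable (A : set (borel X)).
Proof.
move=> Acl; rewrite -[A]setCK; apply: measurableC.
by apply: open_measurable_borel; exact: closed_openC.
Qed.

Lemma continuous_measurable_borel (f : X -> R) :
  continuous f -> measurable_fun [set: borel X] (f : borel X -> R).
Proof.
move=> fc; apply: (measurability _ (RGenOInfty.measurableE R)) => _ [B [a ->] <-].
rewrite setTI; apply: open_measurable_borel.
by apply: open_comp => [x _|]; [exact: fc|exact: rray_open].
Qed.

End borel_sets.

Section integration.
Context d (T : measurableType d) (R : realType).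
Variable mu : {finite_measure set T -> \bar R}.
Implicit Types f g : T -> R.

Lemma bounded_integrable (D : set T) f (M : R) : measurable D ->
  measurable_fun D f -> (forall x, D x -> `|f x| <= M) ->
  mu.-integrable D (EFin \o f).
Proof.
move=> mD mf fM; apply: measurable_bounded_integrable => //.
  by rewrite ltey_eq fin_num_measure.
exists M; split; first exact: num_real.
by move=> N MN x Dx; exact: le_trans (fM _ Dx) (ltW MN).
Qed.

Lemma Rintegral_dist f g (e : R) : mu.-integrable [set: T] (EFin \o f) ->
  mu.-integrable [set: T] (EFin \o g) -> (forall x, `|f x - g x| <= e) ->
  `|\int[mu]_x f x - \int[mu]_x g x| <= e * fine (mu [set: T]).
Proof.
move=> fi gi fge; rewrite -RintegralB//.
have fgi : mu.-integrable [set: T] (EFin \o (fun x => f x - g x)).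
  exact: (integrableB _ fi gi).
rewrite (le_trans (le_normr_Rintegral _ fgi))// -Rintegral_cst//.
apply: le_Rintegral => //; first exact: (integrable_norm fgi).
by apply: finite_measure_integrable_cst.
Qed.

Lemma Rintegral_indic (A : set T) : measurable A ->
  \int[mu]_x \1_A x = fine (mu A).
Proof. by move=> mA; rewrite /Rintegral integral_indic// setIT. Qed.

Lemma Rintegral_sum (n : nat) (F : 'I_n -> T -> R) :
  (forall i, mu.-integrable [set: T] (EFin \o F i)) ->
  \int[mu]_x (\sum_i F i x) = \sum_i \int[mu]_x F i x.
Proof.
move=> Fi; rewrite /Rintegral.
under eq_integral do rewrite -sumEFin.
rewrite integral_sum//= sum_fine// => i _.
exact: integrable_fin_num (Fi i).
Qed.

(** [F \o phi] is a linear combination of indicators of the fibres of [phi]. This is how integrals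
    are computed on the finite Borel partitions used below. *)
Lemma Rintegral_finite_range (n : nat) (phi : T -> 'I_n) (F : 'I_n -> R) :
  (forall i, measurable (phi @^-1` [set i])) ->
  measurable_fun [set: T] (F \o phi) /\
  \int[mu]_x F (phi x) = \sum_i F i * fine (mu (phi @^-1` [set i])).
Proof.
move=> mphi.
have FE : F \o phi = fun x => \sum_i F i * \1_(phi @^-1` [set i]) x.
  apply/funext => x /=; rewrite (bigD1 (phi x))//= big1 ?addr0.
    by rewrite indicE mem_set// mulr1.
  move=> i ix; rewrite indicE memNset ?mulr0// => xi.
  by rewrite -xi eqxx in ix.
have mi i : measurable_fun [set: T] (\1_(phi @^-1` [set i]) : T -> R).
  exact: measurable_indic.
have ii i : mu.-integrable [set: T] (EFin \o \1_(phi @^-1` [set i])).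
  apply: (@bounded_integrable _ _ 1) => // x _.
  by rewrite indicE; case: (_ \in _); rewrite ?normr1 ?normr0.
split.
  rewrite FE; apply: measurable_sum => i.
  by apply: measurable_funM => //.
rewrite [LHS](_ : _ = \int[mu]_x (F \o phi) x)// FE Rintegral_sum.
  apply: eq_bigr => i _.
  by rewrite (RintegralZl _ measurableT (ii i)) Rintegral_indic.
move=> i; exact: (integrableZl measurableT (F i) (ii i)).
Qed.

End integration.

(** * Typicality *)

Section kernel.
Context (R : realType) (X : ptopologicalType) (K : X -> X -> R).
Hypothesis HK : space_with_similarities K.

(** Tube-lemma argument: joint continuity at [(x, y)] gives a neighbourhood of x that works for
    points near y, and compactness makes one neighbourhood work for all y. *)
Lemma kernel_equicontinuous (x : X) (e : R) : 0 < e ->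
  \forall x' \near x, forall y, `|K x' y - K x y| < e.
Proof.
move=> e0; have [Xc _ [Kc _ _]] := HK.
have e20 : 0 < e / 2 by rewrite divr_gt0.
move/compact_near_coveringP : Xc => Xc.
have near_x : \forall x' \near x,
    [set: X] `<=` (fun y => `|K x' y - K x y| < e).
  apply: Xc => y _.
  have /cvgrPdist_lt/(_ _ e20)[[U V] [/= Ux Vy] UV] := Kc (x, y).
  exists (V, U) => //= -[y' x'] [/= Vy' Ux'].
  have h1 := UV (x', y') (conj Ux' Vy').
  have h2 := UV (x, y') (conj (nbhs_singleton Ux) Vy').
  rewrite /= in h1 h2.
  (* The value [K x y] serves as a midpoint: both [K x y'] and [K x' y'] lie within e / 2 of it. *)
  rewrite (_ : _ - _ = (K x y - K x y') - (K x y - K x' y')); last by ring.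
  by rewrite (le_lt_trans (ler_normB _ _))// [ltRHS]splitr ltrD.
by apply: filterS near_x => x' Kx' y; exact: Kx'.
Qed.

Lemma kernel_continuousr (x : X) : continuous (K x).
Proof.
move=> y; have [_ _ [Kc _ _]] := HK.
apply: (@continuous_comp _ _ _ (fun y => (x, y)) (fun p => K p.1 p.2)); last exact: Kc.
by rewrite /continuous_at; apply: cvg_pair => //; exact: cvg_cst.
Qed.

Lemma kernel_measurable (x : X) :
  measurable_fun [set: borel X] (K x : borel X -> R).
Proof. by apply: continuous_measurable_borel; exact: kernel_continuousr. Qed.

Lemma continuous_bounded (f : X -> R) : continuous f ->
  exists M, forall x, `|f x| <= M.
Proof.
move=> fc; have [Xc _ _] := HK.
have [||c _ cmax] := @compact_EVT_max X R (fun x => `|f x|) setT _ Xc.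
- by exists point.
- apply: continuous_subspaceT => x.
  by apply: continuous_comp; [exact: fc|exact: (@norm_continuous R R)].
by exists `|f c| => x; apply: cmax; rewrite inE.
Qed.

Lemma continuous_integrable (mu : {finite_measure set (borel X) -> \bar R})
    (f : X -> R) (D : set (borel X)) : measurable D -> continuous f ->
  mu.-integrable D (EFin \o f).
Proof.
move=> mD fc; have [M fM] := continuous_bounded fc.
apply: (@bounded_integrable _ _ _ _ _ _ M) => //.
by apply: measurable_funTS; exact: continuous_measurable_borel.
Qed.

Lemma kernel_integrable (mu : {finite_measure set (borel X) -> \bar R}) (x : X) :
  mu.-integrable [set: borel X] (EFin \o K x).
Proof. by apply: continuous_integrable => //; exact: kernel_continuousr. Qed.

Lemma typicality_close (mu : {finite_measure set (borel X) -> \bar R})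
    (x x' : X) (e : R) : (forall y, `|K x y - K x' y| <= e) ->
  `|typicality K mu x - typicality K mu x'| <= e * fine (mu [set: borel X]).
Proof. by move=> xx'; apply: Rintegral_dist => //; exact: kernel_integrable. Qed.

Lemma typicality_continuous (mu : {finite_measure set (borel X) -> \bar R}) :
  continuous (typicality K mu : X -> R).
Proof.
move=> x; apply/cvgrPdist_lt => e e0.
(* Adding 1 keeps the divisor positive even for the zero measure. *)
have m0 : 0 < fine (mu [set: borel X]) + 1 by rewrite ltr_wpDl// fine_ge0.
have d0 : 0 < e / (fine (mu [set: borel X]) + 1) by rewrite divr_gt0.
have := kernel_equicontinuous x d0; apply: filterS => x' xx'.
rewrite distrC (le_lt_trans (typicality_close _ (fun y => ltW (xx' y))))//.
rewrite -mulrAC ltr_pdivrMr// ltr_pM2l// ltrDl//.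
Qed.

Lemma compact_borel (C : set X) : compact C -> measurable (C : set (borel X)).
Proof.
by have [_ Xh _] := HK => Cc; apply: closed_measurable_borel; exact: compact_closed.
Qed.

(* Points are sent to the first member of a finite net to which they are
   K-close. *)
Lemma finite_net (e : R) : 0 < e -> exists (n : nat) (s : 'I_n -> X)
    (phi : X -> 'I_n),
  (forall i, measurable (phi @^-1` [set i] : set (borel X))) /\
  forall x y, `|K x y - K (s (phi x)) y| < e.
Proof.
move=> e0; have [Xc _ _] := HK.
pose N (x : X) := [set x' | forall y, `|K x' y - K x y| < e].
move: Xc; rewrite compact_cover => /(_ X setT (fun x => (N x)^°)).
case=> [x _|x _|D _ cD]; first exact: open_interior.
  by exists x => //; exact: (kernel_equicontinuous x e0).
pose b z x := `[< (N z)^° x >].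
(* The first index is i + 1 exactly when x escapes the neighbourhood of the head and has first index
   i in the tail, so the fibres are Borel by induction on the list. Interiors are taken because
   [N z] itself is not known to be open. *)
have mfind (s : seq X) (i : nat) :
    measurable ([set x | find (b^~ x) s = i] : set (borel X)).
  elim: s i => [i|z s IH [|i]] /=.
  - by have [->|i0] := eqVneq 0%N i; [rewrite (_ : mkset _ = setT)|
      rewrite (_ : mkset _ = set0)] => //; apply/seteqP; split => // x /= xi;
      rewrite xi eqxx in i0.
  - rewrite (_ : mkset _ = (N z)^°); last first.
      apply/seteqP; split => x /=; rewrite /b; case: ifPn => //.
        by move/asboolP.
      by move=> /asboolPn.
    by apply: open_measurable_borel; exact: open_interior.
  - rewrite (_ : mkset _ = ~` (N z)^° `&` [set x | find (b^~ x) s = i]).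
      apply: measurableI => //; apply: measurableC.
      by apply: open_measurable_borel; exact: open_interior.
    apply/seteqP; split => x /=; rewrite /b; case: ifPn => //.
    + by move=> /asboolPn Nx [].
    + by move=> /asboolP Nx [].
    + by move=> /asboolPn Nx [_ ->].
pose s := finmap.enum_fset D.
have hs x : has (b^~ x) s.
  have [z zD zx] := cD x I; apply/hasP; exists z => //.
  exact/asboolP.
have fs x : (find (b^~ x) s < size s)%N by rewrite -has_find.
exists (size s), (fun i => nth point s i), (fun x => Ordinal (fs x)); split.
  move=> i; rewrite (_ : _ @^-1` _ = [set x | find (b^~ x) s = i])//.
  apply/seteqP; split => x /=; first by move=> <-.
  by move=> xi; apply/val_inj.
move=> x y /=.
have /asboolP/interior_subset := nth_find point (hs x).
exact.
Qed.

End kernel.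

(** * Radon measures and their supports *)

Section radon_measures.
Context (R : realType) (X : ptopologicalType).
Hypothesis Xh : hausdorff_space X.
Implicit Types mu : {finite_measure set (borel X) -> \bar R}.

Lemma radon_approx mu (A : set (borel X)) (e : R) : radon mu -> measurable A ->
  0 < e -> exists C : set X,
    [/\ compact C, C `<=` A & (mu A <= mu (C : set (borel X)) + e%:E)%E].
Proof.
move=> rmu mA e0; have muA := fin_num_measure mu A mA.
have := rmu A mA => muAE.
have [_ [C [Cc CA] <-]] := ub_ereal_sup_adherent e0 (etrans (congr1 _ (esym muAE)) muA).
rewrite -muAE => h; exists C; split => //.
by rewrite -leeBlDr// ltW.
Qed.

(** This converse of [radon_approx] gives an epsilon form of inner regularity, which is easy to
    transport along a map. *)
Lemma approx_radon mu :
  (forall (A : set (borel X)) (e : R), measurable A -> 0 < e -> exists C : set X,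
    [/\ compact C, C `<=` A & (mu A <= mu (C : set (borel X)) + e%:E)%E]) ->
  radon mu.
Proof.
move=> h A mA; apply/eqP; rewrite eq_le; apply/andP; split.
  apply/lee_addgt0Pr => e e0; have [C [Cc CA muA]] := h A e mA e0.
  by rewrite (le_trans muA)// leeD2r// ereal_sup_ubound//; exists C.
apply: ge_ereal_sup => _ [C [Cc CA] <-]; rewrite le_measure ?inE//.
by apply: closed_measurable_borel; exact: compact_closed.
Qed.

Lemma closed_supp mu : closed (supp mu).
Proof. by apply: closed_bigI => C []. Qed.

Lemma measurable_supp mu : measurable (supp mu : set (borel X)).
Proof. by apply: closed_measurable_borel; exact: closed_supp. Qed.

Lemma open_null_supp mu (U : set X) : open U -> mu (U : set (borel X)) = 0%E ->
  supp mu `<=` ~` U.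
Proof.
by move=> oU U0 x; apply; split; [exact: open_closedC|rewrite setCK].
Qed.

(** The complement of the support is a union of null open sets, possibly uncountable. Inner
    regularity reduces the claim to a compact subset, which finitely many of them cover. *)
Lemma radon_suppC mu : radon mu -> mu (~` supp mu) = 0%E.
Proof.
move=> rmu; rewrite rmu; last by apply: measurableC; exact: measurable_supp.
apply/eqP; rewrite eq_le; apply/andP; split; last first.
  apply: ereal_sup_ubound; exists set0; last exact: measure0.
  by split; [exact: compact0|exact: sub0set].
apply: ge_ereal_sup => _ [C [Cc CS] <-].
have /choice[U HU] (x : X) : exists U : set X, C x ->
    [/\ open U, mu (U : set (borel X)) = 0%E & U x].
  have [Cx|nCx] := pselect (C x); last by exists set0.
  have /existsNP[F /not_implyP[[Fc F0] Fx]] := CS _ Cx.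
  by exists (~` F) => _; split => //; exact: closed_openC.
have mC : measurable (C : set (borel X)).
  by apply: closed_measurable_borel; exact: compact_closed.
move: Cc; rewrite compact_cover => /(_ X C U).
case=> [x /HU[]//|x Cx|D DC cD]; first by exists x => //; have [] := HU _ Cx.
have null (s : seq X) : {subset s <= C} ->
    mu.-negligible (\big[setU/set0]_(x <- s) (U x : set (borel X))).
  elim: s => [_|x s IH sC]; first by rewrite big_nil; exact: negligible_set0.
  rewrite big_cons; apply: negligibleU; last first.
    by apply: IH => y ys; apply: sC; rewrite in_cons ys orbT.
  have [|oU U0 _] := HU x; first by apply/set_mem/sC; rewrite in_cons eqxx.
  by apply/negligibleP => //; exact: open_measurable_borel.
have /negligibleP-> // : mu.-negligible (C : set (borel X)).
apply: (negligibleS _ (null (finmap.enum_fset D) _)).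
  by move=> x /cD[i iD Uix]; rewrite -bigcup_seq; exists i.
by move=> x xD; exact: DC.
Qed.

Lemma radon_supp mu : radon mu -> mu (supp mu) = mu [set: borel X].
Proof.
move=> rmu; rewrite -(setUv (supp mu)) measureU ?setICr//.
- by rewrite [X in (_ + X)%E](radon_suppC rmu) adde0.
- exact: measurable_supp.
- by apply: measurableC; exact: measurable_supp.
Qed.

Lemma radon_ae_supp mu (P : borel X -> Prop) : radon mu ->
  (forall x, supp mu x -> P x) -> {ae mu, forall x, P x}.
Proof.
move=> rmu SP; exists (~` supp mu); split => //.
- by apply: measurableC; exact: measurable_supp.
- exact: radon_suppC.
- by move=> x /= nPx /SP.
Qed.

End radon_measures.

Section typicality.
Context (R : realType) (X : ptopologicalType) (K : X -> X -> R).
Hypothesis HK : space_with_similarities K.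
Implicit Types mu la : {finite_measure set (borel X) -> \bar R}.

(** The set U where [K x] exceeds [K x x / 2] is an open neighbourhood of x, hence not null as x
    lies in the support, and the integral is at least [K x x / 2] times its mass. *)
Lemma typicality_supp_gt0 mu x : supp mu x -> 0 < typicality K mu x.
Proof.
move=> xmu; have [_ _ [_ K0 Kx]] := HK.
pose U := [set y | K x x / 2 < K x y].
have oU : open U.
  rewrite (_ : U = K x @^-1` [set z | K x x / 2 < z])//.
  by apply: open_comp => [y _|]; [exact: kernel_continuousr|exact: open_gt].
have mU : measurable (U : set (borel X)) by exact: open_measurable_borel.
have U_gt0 : 0 < fine (mu U).
  rewrite lt_neqAle fine_ge0 ?andbT//; apply/eqP => U0.
  have muU0 : mu (U : set (borel X)) = 0%E.
    by rewrite -[LHS]fineK ?fin_num_measure// -U0.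
  apply: (open_null_supp oU muU0 xmu); rewrite /U /=.
  by rewrite ltr_pdivrMr// ltr_pMr// ltr1n.
apply: (@lt_le_trans _ _ (K x x / 2 * fine (mu U))).
  by rewrite mulr_gt0// divr_gt0.
have Ui : mu.-integrable [set: borel X] (EFin \o \1_U) by exact: integrable_indic.
rewrite -Rintegral_indic// -RintegralZl//.
have Ui2 := integrableZl measurableT (K x x / 2) Ui.
apply: (le_Rintegral _ Ui2) => //; first exact: kernel_integrable.
move=> y _; rewrite indicE; case: (boolP (y \in U)) => /=.
  by rewrite inE mulr1 => /ltW.
by rewrite mulr0.
Qed.

(** Positivity becomes uniform because the support is compact and the typicality continuous; an
    empty support makes any bound valid. *)
Lemma typicality_supp_lb mu :
  exists2 m, 0 < m & forall x, supp mu x -> m <= typicality K mu x.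
Proof.
have [Xc Xh _] := HK.
have [[x0 x0S]|S0] := pselect (supp mu !=set0); last first.
  by exists 1 => // x Sx; exfalso; apply: S0; exists x.
have Sc : compact (supp mu).
  by apply: (subclosed_compact _ Xc) => //; exact: closed_supp.
have [||c cS cmin] := @compact_EVT_min X R (typicality K mu) (supp mu) _ Sc.
- by exists x0.
- by apply: continuous_subspaceT; exact: typicality_continuous.
exists (typicality K mu c).
  by apply: typicality_supp_gt0; exact/set_mem.
by move=> x /mem_set /cmin.
Qed.

Lemma typicality_measurable mu :
  measurable_fun [set: borel X] (typicality K mu : borel X -> R).
Proof. by apply: continuous_measurable_borel; exact: typicality_continuous. Qed.

Lemma typicality_integrable mu la (D : set (borel X)) : measurable D ->
  la.-integrable D (EFin \o typicality K mu).
Proof.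
by move=> mD; apply: (continuous_integrable HK) => //; exact: typicality_continuous.
Qed.

(** Symmetry moves the net approximation from the first argument of K to the variable of
    integration, so mu may be replaced by its masses on the partition. *)
Lemma typicality_net (Ksym : symmetric_kernel K) (e : R) (n : nat)
    (s : 'I_n -> X) (phi : X -> 'I_n) :
  (forall i, measurable (phi @^-1` [set i] : set (borel X))) ->
  (forall x y, `|K x y - K (s (phi x)) y| < e) ->
  forall mu x, `|typicality K mu x -
    \sum_i K (s i) x * fine (mu (phi @^-1` [set i]))| <= e * fine (mu [set: borel X]).
Proof.
move=> mphi sphi mu x.
have [mF intF] := Rintegral_finite_range mu (fun i => K (s i) x) mphi.
rewrite -intF; apply: Rintegral_dist.
- exact: kernel_integrable.
- have [M KM] := continuous_bounded HK (kernel_continuousr HK (x := x)).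
  apply: (@bounded_integrable _ _ _ _ _ _ M) => // y _ /=.
  by rewrite Ksym KM.
- by move=> y; rewrite Ksym ltW.
Qed.

(* Fubini's theorem for K, which needs no measurability of K for the product
   of the Borel sigma-algebras because K is a uniform limit of kernels
   depending on one variable only through a finite Borel partition. *)
Lemma typicality_swap (Ksym : symmetric_kernel K) mu la :
  \int[la]_x typicality K mu x = \int[mu]_x typicality K la x.
Proof.
apply/eqP; rewrite -subr_eq0 -normr_le0; apply/ler_addgt0Pr => e e0.
set M := fine (mu [set: borel X]); set L := fine (la [set: borel X]).
have M0 : 0 <= M by rewrite fine_ge0.
have L0 : 0 <= L by rewrite fine_ge0.
(* Two errors of size [d * M * L] must add up to at most e; the 1 covers the case where M or L is
   0. *)
have d0 : 0 < e / (2 * M * L + 1) by rewrite divr_gt0// ltr_wpDl// !mulr_ge0.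
have [n [s [phi [mphi sphi]]]] := finite_net HK d0.
set d := e / _ in d0 sphi.
(* S is the double integral with [la] concentrated on the net; both iterated integrals are compared
   with it. *)
pose S := \sum_i typicality K mu (s i) * fine (la (phi @^-1` [set i])).
have h1 : `|\int[la]_x typicality K mu x - S| <= d * M * L.
  have [mF intF] := Rintegral_finite_range la (fun i => typicality K mu (s i)) mphi.
  rewrite /S -intF; apply: Rintegral_dist.
  - exact: typicality_integrable.
  - have [B tB] := continuous_bounded HK (typicality_continuous HK (mu := mu)).
    by apply: (@bounded_integrable _ _ _ _ _ _ B) => // y _ /=.
  - by move=> x; apply: typicality_close => // y; rewrite ltW.
have h2 : `|\int[mu]_x typicality K la x - S| <= d * L * M.
  have Ki i : mu.-integrable [set: borel X]
      (EFin \o (fun x => K (s i) x * fine (la (phi @^-1` [set i])))).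
    rewrite (_ : _ \o _ = fun x => ((fine (la (phi @^-1` [set i])))%:E *
      (EFin \o K (s i)) x)%E); last by apply/funext => x /=; rewrite mulrC EFinM.
    by apply: integrableZl => //; exact: kernel_integrable.
  have -> : S = \int[mu]_x \sum_i K (s i) x * fine (la (phi @^-1` [set i])).
    rewrite Rintegral_sum//; apply: eq_bigr => i _.
    by rewrite RintegralZr//; exact: kernel_integrable.
  apply: Rintegral_dist; last exact: typicality_net.
    exact: typicality_integrable.
  rewrite (_ : _ \o _ = fun x => (\sum_i
    (K (s i) x * fine (la (phi @^-1` [set i])))%:E)%E); last first.
    by apply/funext => x /=; rewrite sumEFin.
  by apply: integrable_sum => // i _; exact: Ki.
have -> : \int[la]_x typicality K mu x - \int[mu]_x typicality K la x =
    (\int[la]_x typicality K mu x - S) - (\int[mu]_x typicality K la x - S) by ring.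
rewrite (le_trans (ler_normB _ _))// add0r (le_trans (lerD h1 h2))//.
rewrite (_ : _ + _ = d * (2 * M * L)); last by ring.
rewrite /d -mulrAC ler_pdivrMr; last by rewrite ltr_wpDl// !mulr_ge0.
by rewrite ler_pM2l// lerDl.
Qed.

End typicality.

(** * Weight measures and magnitude *)

Section charges.
Context (R : realType) (X : ptopologicalType).
Hypothesis Xh : hausdorff_space X.
Implicit Types nu : {charge set (borel X) -> \bar R}.

Lemma eq_radon (m1 m2 : set (borel X) -> \bar R) :
  (forall A, measurable A -> m1 A = m2 A) -> radon m1 -> radon m2.
Proof.
move=> m12 rm1 A mA; rewrite -m12// rm1//.
congr ereal_sup; apply: eq_imagel => C [Cc _].
by rewrite m12//; apply: closed_measurable_borel; exact: compact_closed.
Qed.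

Definition nonneg_charge nu :=
  forall A : set (borel X), measurable A -> (0 <= nu A)%E.

(** On the negative set of the chosen Hahn decomposition a nonnegative charge is both at least and
    at most 0. *)
Lemma jordan_neg_nonneg nu (A : set (borel X)) : nonneg_charge nu ->
  measurable A -> jordan_neg (hahn_of nu) A = 0%E.
Proof.
move=> nu0 mA; rewrite jordan_negE cjordan_negE /crestr0 mem_set// /crestr.
have [_ [mN Nneg] _ _] := hahn_of nu.
apply/eqP; rewrite oppe_eq0 eq_le nu0 ?andbT; last exact: measurableI.
by apply: Nneg; [exact: measurableI|exact: subIsetr].
Qed.

Lemma jordan_pos_nonneg nu (A : set (borel X)) : nonneg_charge nu ->
  measurable A -> jordan_pos (hahn_of nu) A = nu A.
Proof.
move=> nu0 mA; rewrite [RHS](jordan_decomp (hahn_of nu) mA) /cadd/=.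
by rewrite cscaleN1 [X in (_ - X)%E](jordan_neg_nonneg nu0 mA) oppe0 adde0.
Qed.

Lemma charge_variation_nonneg nu (A : set (borel X)) : nonneg_charge nu ->
  measurable A -> charge_variation (hahn_of nu) A = nu A.
Proof.
move=> nu0 mA; rewrite /charge_variation/=.
by rewrite [X in (_ + X)%E](jordan_neg_nonneg nu0 mA) adde0 jordan_pos_nonneg.
Qed.

Lemma charge_typicality_nonneg (K : X -> X -> R) nu
    (m : {measure set (borel X) -> \bar R}) (x : X) : nonneg_charge nu ->
  (forall A, measurable A -> m A = nu A) ->
  charge_typicality K nu x = typicality K m x.
Proof.
move=> nu0 mnu; rewrite /charge_typicality /typicality /Rintegral.
rewrite (eq_measure_integral m)/=; last first.
  by move=> A mA _; rewrite mnu//; exact: jordan_pos_nonneg.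
rewrite [X in _ - fine X](eq_measure_integral mzero)/=; last first.
  by move=> A mA _; exact: jordan_neg_nonneg.
by rewrite integral_measure_zero subr0.
Qed.

Lemma finite_measure_weight (K : X -> X -> R)
    (m : {finite_measure set (borel X) -> \bar R}) :
  radon m -> (forall x, typicality K m x = 1) ->
  exists2 nu, positive_weight_measure K nu &
    forall A, measurable A -> nu A = m A.
Proof.
move=> rm Km; pose nu : {charge set (borel X) -> \bar R} :=
  charge_of_finite_measure m.
have nu0 : nonneg_charge nu by move=> A mA; exact: measure_ge0.
exists nu => //; split => //; split.
  by apply: eq_radon rm => A mA; rewrite charge_variation_nonneg.
by move=> x; rewrite (@charge_typicality_nonneg K nu m).
Qed.

End charges.

Section magnitude.
Context (R : realType) (X : ptopologicalType) (K : X -> X -> R).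
Hypotheses (HK : space_with_similarities K) (Ksym : symmetric_kernel K).
Implicit Types nu : {charge set (borel X) -> \bar R}.

(** The mass of nu is the integral of [K nu'] against nu, which by symmetry and Fubini is the
    integral of [K nu] against nu', the mass of nu'. Here nu may be signed, since [magnitude]
    selects among all weight measures; it is split into its Jordan parts. *)
Lemma weight_mass nu nu' : weight_measure K nu -> positive_weight_measure K nu' ->
  fine (nu [set: borel X]) = fine (nu' [set: borel X]).
Proof.
move=> [_ Knu] [[_ Knu'] nu'0].
pose m := jordan_pos (hahn_of nu').
pose p := jordan_pos (hahn_of nu); pose n := jordan_neg (hahn_of nu).
have Km x : typicality K m x = 1.
  by rewrite -(Knu' x); apply/esym/charge_typicality_nonneg => // A mA;
    exact: jordan_pos_nonneg.
have mass (la : {finite_measure set (borel X) -> \bar R}) :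
    fine (la [set: borel X]) = \int[m]_x typicality K la x.
  rewrite -typicality_swap//.
  by rewrite (@eq_Rintegral _ _ _ _ _ (cst 1))// ?Rintegral_cst ?mul1r.
transitivity (fine (p [set: borel X]) - fine (n [set: borel X])).
  rewrite (jordan_decomp (hahn_of nu) measurableT) /cadd/= cscaleN1.
  by rewrite fineD ?fineN// ?fin_numN fin_num_measure.
rewrite !mass -RintegralB//; try exact: typicality_integrable.
rewrite (@eq_Rintegral _ _ _ _ _ (cst 1)); last by move=> x _; exact: Knu.
by rewrite Rintegral_cst// mul1r; congr fine; exact: jordan_pos_nonneg.
Qed.

Lemma magnitudeE nu : positive_weight_measure K nu ->
  magnitude K = fine (nu [set: borel X]).
Proof.
move=> wnu; rewrite /magnitude.
have [|nu' [wnu' ->]] := @getPex _ [set m : R | exists nu,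
  weight_measure K nu /\ m = fine (nu [set: borel X])].
  by exists (fine (nu [set: borel X])), nu; split => //; case: wnu.
exact: weight_mass.
Qed.

End magnitude.

(** * Diversity *)

Section tangents.
Context (R : realType).
Implicit Types t M p : R.

(** With s = 1 / t this writes s^p as M^p times the exponential of p ln(s / M), so that tangency at
    s = M becomes an inequality for [expR] at 0. *)
Lemma powRN_scale t M p : 0 < t -> 0 < M ->
  t `^ (- p) = M `^ p * expR (p * ln (t `^ (-1) / M)).
Proof.
move=> t0 M0; rewrite -ln_powR lnK ?posrE ?powR_gt0 ?divr_gt0 ?powR_gt0//.
rewrite -powRM ?divr_ge0 ?powR_ge0 ?ltW// mulrC divfK ?gt_eqF//.
by rewrite -powRrM mulN1r.
Qed.

(** The function s^p of s = 1 / t is concave for these p, so it lies below its tangent at s = M. *)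
Lemma powRN_le_tangent t M p : 0 < t -> 0 < M -> 0 < p <= 1 ->
  t `^ (- p) <= M `^ p * (1 - p) + M `^ p * p / M * t `^ (-1).
Proof.
move=> t0 M0 /andP[p0 p1]; rewrite (powRN_scale p t0 M0).
have u0 : 0 < t `^ (-1) / M by rewrite divr_gt0 ?powR_gt0.
rewrite (_ : _ + _ = M `^ p * (1 - p + p * (t `^ (-1) / M))); last by ring.
rewrite ler_wpM2l ?powR_ge0// -{2}[_ / M]lnK ?posrE//.
set y := ln _; pose e := expR (p * y).
have e0 : 0 <= e by exact: expR_ge0.
have E1 : e * expR (- (p * y)) = 1 by rewrite -expRD subrr expR0.
have E2 : e * expR ((1 - p) * y) = expR y by rewrite -expRD; congr expR; ring.
(* The claim is now expR (p y) <= 1 - p + p expR y. It is the sum of [h1] and [h2], whose terms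
   linear in y cancel. *)
have h1 : 0 <= e * (1 - p) * (expR (- (p * y)) - (1 + - (p * y))).
  by rewrite !mulr_ge0 ?subr_ge0// expR_ge1Dx.
have h2 : 0 <= e * p * (expR ((1 - p) * y) - (1 + (1 - p) * y)).
  by rewrite !mulr_ge0 ?subr_ge0 ?expR_ge1Dx// ltW.
rewrite -/e -E2 -[X in _ <= X + _]mul1r -{1}E1; lra.
Qed.

(** For p <= 0 the function s^p is convex and lies above the same tangent. *)
Lemma powRN_ge_tangent t M p : 0 < t -> 0 < M -> p <= 0 ->
  M `^ p * (1 - p) + M `^ p * p / M * t `^ (-1) <= t `^ (- p).
Proof.
move=> t0 M0 p0; rewrite [leRHS](powRN_scale p t0 M0).
have u0 : 0 < t `^ (-1) / M by rewrite divr_gt0 ?powR_gt0.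
rewrite (_ : _ + _ = M `^ p * (1 - p + p * (t `^ (-1) / M))); last by ring.
rewrite ler_wpM2l ?powR_ge0// -{1}[_ / M]lnK ?posrE//.
set y := ln _; apply: le_trans (expR_ge1Dx _).
have h : p * expR y <= p * (1 + y) by rewrite ler_wnM2l// expR_ge1Dx.
by lra.
Qed.

Lemma le0_ler_powR p x y : p <= 0 -> 0 < x -> x <= y -> y `^ p <= x `^ p.
Proof.
move=> p0 x0 xy; have y0 := lt_le_trans x0 xy.
rewrite -[p]opprK [leLHS]powRN [leRHS]powRN lef_pV2 ?posrE ?powR_gt0//.
by apply: ge0_ler_powR; rewrite ?nnegrE ?oppr_ge0// ltW.
Qed.

Lemma lnN_le_tangent t M : 0 < t -> 0 < M ->
  - ln t <= (ln M - 1) + M^-1 * t `^ (-1).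
Proof.
move=> t0 M0; have u0 : 0 < t `^ (-1) / M by rewrite divr_gt0 ?powR_gt0.
have -> : - ln t = ln M + ln (t `^ (-1) / M).
  by rewrite ln_div ?posrE ?powR_gt0// ln_powR; ring.
have := expR_ge1Dx (ln (t `^ (-1) / M)); rewrite lnK ?posrE//.
by rewrite [M^-1 * _]mulrC; lra.
Qed.

End tangents.

Section diversity.
Context (R : realType) (X : ptopologicalType) (K : X -> X -> R).
Hypothesis HK : space_with_similarities K.
Variable mu : probability (borel X) R.
Hypothesis rmu : radon mu.
Local Notation t := (typicality K mu).
Local Notation S := (supp mu).

Let mS : measurable (S : set (borel X)). Proof. exact: measurable_supp. Qed.

Let muS : mu S = 1%E.
Proof.
have [_ Xh _] := HK; rewrite (radon_supp Xh (mu := mu) rmu).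
exact: probability_setT.
Qed.

Let mu_gt0 : (0 < mu [set: borel X])%E.
Proof. by rewrite [ltRHS]probability_setT. Qed.

Let intS_cst a : \int[mu]_(x in S) a = a.
Proof. by rewrite Rintegral_cst// [X in fine X]muS mulr1. Qed.

Let t_gt0 x : S x -> 0 < t x. Proof. exact: typicality_supp_gt0. Qed.

Let tm : measurable_fun (S : set (borel X)) t.
Proof. by apply: measurable_funTS; exact: typicality_measurable. Qed.

Let t_bounds : exists m B, [/\ 0 < m, 0 < B & forall x, S x -> m <= t x <= B].
Proof.
have [m m0 mt] := typicality_supp_lb HK mu.
have [B tB] := continuous_bounded HK (typicality_continuous HK (mu := mu)).
exists m, (B + 1); split => //.
  by rewrite ltr_wpDl// (le_trans _ (tB point)).
by move=> x Sx; rewrite mt//= (le_trans (ler_norm _))// ler_wpDr.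
Qed.

Lemma powR_typicality_integrable a :
  mu.-integrable S (EFin \o (fun x => t x `^ a)).
Proof.
have [m [B [m0 B0 tmB]]] := t_bounds.
apply: (@bounded_integrable _ _ _ _ _ _ (m `^ a + B `^ a)) => //.
  exact: (measurableT_comp (@measurable_powR R a) tm).
move=> x Sx; have /andP[mt tB] := tmB x Sx; have t0 := t_gt0 Sx.
rewrite ger0_norm ?powR_ge0//.
have [a0|a0] := leP 0 a.
  apply: (@le_trans _ _ (B `^ a)); last by rewrite lerDr powR_ge0.
  by apply: ge0_ler_powR => //; rewrite nnegrE ltW.
apply: (@le_trans _ _ (m `^ a)); last by rewrite lerDl powR_ge0.
by apply: le0_ler_powR => //; exact: ltW.
Qed.

Lemma ln_typicality_integrable : mu.-integrable S (EFin \o (fun x => ln (t x))).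
Proof.
have [m [B [m0 B0 tmB]]] := t_bounds.
apply: (@bounded_integrable _ _ _ _ _ _ (`|ln m| + `|ln B|)) => //.
  exact: (measurableT_comp (@measurable_ln R) tm).
move=> x Sx; have /andP[mt tB] := tmB x Sx; have t0 := t_gt0 Sx.
have h1 : ln m <= ln (t x) by rewrite ler_ln ?posrE.
have h2 : ln (t x) <= ln B by rewrite ler_ln ?posrE.
have := ler_norm (ln B); have := lerNnormlW (lexx `|ln m|).
have := normr_ge0 (ln m); have := normr_ge0 (ln B).
by rewrite ler_norml; lra.
Qed.

Let M := \int[mu]_(x in S) (t x `^ (-1)).

Lemma Rintegral_affine a b :
  \int[mu]_(x in S) (a + b * t x `^ (-1)) = a + b * M /\
  mu.-integrable S (EFin \o (fun x => a + b * t x `^ (-1))).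
Proof.
have i1 : mu.-integrable S (EFin \o cst a) by exact: finite_measure_integrable_cst.
have i2 : mu.-integrable S (EFin \o (fun x => b * t x `^ (-1))).
  exact: (integrableZl mS b (powR_typicality_integrable (-1))).
split; last exact: (integrableD mS i1 i2).
rewrite RintegralD// RintegralZl//; last exact: powR_typicality_integrable.
by rewrite intS_cst.
Qed.

Lemma diversity0E : diversity K 0%E mu = M.
Proof.
rewrite /diversity/= eq_sym oner_eq0 sub0r subr0 divr1 powRr1//.
by apply: Rintegral_ge0 => x _; exact: powR_ge0.
Qed.

Lemma diversity0_gt0 : 0 < M.
Proof.
have [m [B [m0 B0 tmB]]] := t_bounds.
apply: (@lt_le_trans _ _ (B^-1)); first by rewrite invr_gt0.
have -> : B^-1 = \int[mu]_(x in S) cst (B^-1) x.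
  by rewrite intS_cst.
apply: le_Rintegral => //.
- exact: finite_measure_integrable_cst.
- exact: powR_typicality_integrable.
move=> x Sx; have /andP[mt tB] := tmB x Sx; have t0 := t_gt0 Sx.
by rewrite /= powR_inv1 ?(ltW t0)// lef_pV2 ?posrE.
Qed.

Lemma ess_sup_typicality : exists tau, [/\ 0 < tau,
  ess_sup mu (fun x => (t x)%:E) = tau%:E & forall x, S x -> t x <= tau].
Proof.
have [_ Xh _] := HK.
have [m [B [m0 B0 tmB]]] := t_bounds.
set T := ess_sup _ _.
have TB : (T <= B%:E)%E.
 apply/ess_supP; apply: (radon_ae_supp Xh (mu := mu) rmu) => x /tmB /andP[_].
  by rewrite lee_fin.
have mT : (m%:E <= T)%E.
  apply: ess_sup_gee; first exact: mu_gt0.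
  apply: (radon_ae_supp Xh (mu := mu) rmu) => x /tmB /andP[].
  by rewrite lee_fin.
have TE : T = (fine T)%:E.
  rewrite fineK// fin_numElt (lt_le_trans _ mT) ?ltNyr//.
  by rewrite (le_lt_trans TB) ?ltry.
exists (fine T); split => //.
  by rewrite (lt_le_trans m0)// -lee_fin -TE.
move=> x Sx; rewrite leNgt; apply/negP => tx.
pose U := [set y | fine T < t y].
have oU : open U.
  rewrite (_ : U = t @^-1` [set z | fine T < z])//.
  by apply: open_comp => [y _|]; [exact: typicality_continuous|exact: open_gt].
apply: (open_null_supp oU _ Sx tx).
apply/negligibleP; first exact: open_measurable_borel.
have : {ae mu, forall x, ((t x)%:E <= T)%E} by exact: ess_sup_ge.
move=> [N [mN N0 TN]]; exists N; split => // y Uy; apply: TN => /=.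
by rewrite TE lee_fin leNgt; apply/negP; rewrite negbK.
Qed.

(* Tangent-line (Jensen) inequalities for [s |-> s^(1-q)] and [ln] at the mean
   of [s = 1 / K mu]. *)
Lemma diversity_le0 (q : \bar R) : (0 <= q)%E ->
  diversity K q mu <= diversity K 0%E mu.
Proof.
have M0 := diversity0_gt0.
have ip := powR_typicality_integrable.
rewrite diversity0E; case: q => [r r0| _|//] /=; last first.
  have [tau [tau0 -> ttau]] := ess_sup_typicality.
  have -> : tau^-1 = \int[mu]_(x in S) cst (tau^-1) x.
    by rewrite intS_cst.
  apply: le_Rintegral => //; first exact: finite_measure_integrable_cst.
  move=> x Sx; have t0 := t_gt0 Sx.
  by rewrite /= powR_inv1 ?(ltW t0)// lef_pV2 ?posrE// ttau.
have affine_eq a b c : a + b * M = c -> \int[mu]_(x in S) (a + b * t x `^ (-1)) = c.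
  by move=> <-; have [] := Rintegral_affine a b.
case: ifPn => [_|r1].
  rewrite -[leRHS](lnK M0) ler_expR.
  have -> : - (\int[mu]_(x in S) ln (t x)) = \int[mu]_(x in S) (-1 * ln (t x)).
    by rewrite RintegralZl ?mulN1r//; exact: ln_typicality_integrable.
  rewrite -(affine_eq (ln M - 1) M^-1 (ln M)); last first.
    by rewrite mulVf ?gt_eqF//; ring.
  apply: le_Rintegral => //.
  - exact: (integrableZl mS (-1) ln_typicality_integrable).
  - by have [] := Rintegral_affine (ln M - 1) M^-1.
  - by move=> x Sx; rewrite mulN1r lnN_le_tangent// t_gt0.
pose p := 1 - r.
have rp : r - 1 = - p by rewrite /p; ring.
have p0 : p != 0 by rewrite subr_eq0 eq_sym.
have MpE : M = (M `^ p) `^ (1 / p).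
  by rewrite -powRrM mulrCA divff// mulr1 powRr1// ltW.
have aff : \int[mu]_(x in S) (M `^ p * (1 - p) + M `^ p * p / M * t x `^ (-1)) = M `^ p.
  by apply: affine_eq; field; rewrite gt_eqF.
have [_ iaff] := Rintegral_affine (M `^ p * (1 - p)) (M `^ p * p / M).
rewrite -/p rp [leRHS]MpE -aff.
have [pp|p_ge0] := ltP p 0.
- apply: le0_ler_powR; rewrite ?aff ?powR_gt0//.
    by rewrite div1r invr_le0 ltW.
  rewrite -aff; apply: le_Rintegral => // x Sx.
  by rewrite powRN_ge_tangent ?(ltW pp)// t_gt0.
- have pp : 0 < p by rewrite lt_neqAle eq_sym p0.
  rewrite ge0_ler_powR ?nnegrE ?divr_ge0 ?(ltW pp)//.
  + by apply: Rintegral_ge0 => x _; exact: powR_ge0.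
  + by rewrite aff powR_ge0.
  + apply: le_Rintegral => // x Sx; apply: powRN_le_tangent => //.
      exact: t_gt0.
    by rewrite pp /p gerBl -lee_fin.
Qed.

Lemma diversity_balanced (c : R) (q : \bar R) : (0 <= q)%E -> 0 < c ->
  (forall x, S x -> t x = c) -> diversity K q mu = c^-1.
Proof.
move=> q0 c0 tc.
have [_ Xh _] := HK.
case: q q0 => [r r0|_|//] /=; last first.
  rewrite (_ : ess_sup _ _ = c%:E)//; apply: ess_sup_ae_cst; first exact: mu_gt0.
  by apply: (radon_ae_supp Xh (mu := mu) rmu) => x /tc ->.
case: ifPn => [_|r1].
  rewrite (@eq_Rintegral _ _ _ _ _ (cst (ln c))); last first.
    by move=> x /set_mem /tc ->.
  by rewrite intS_cst -lnV ?posrE// lnK ?posrE ?invr_gt0.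
rewrite (@eq_Rintegral _ _ _ _ _ (cst (c `^ (r - 1)))); last first.
  by move=> x /set_mem /tc ->.
rewrite intS_cst -powRrM.
rewrite (_ : (r - 1) * _ = -1) ?powR_inv1 ?(ltW c0)//.
by field; rewrite subr_eq0 eq_sym.
Qed.

Lemma balanced_of_diversity_le :
  diversity K 0%E mu <= diversity K +oo%E mu ->
  forall x, S x -> t x = (diversity K 0%E mu)^-1.
Proof.
have [_ Xh _] := HK; have M0 := diversity0_gt0; rewrite diversity0E /=.
have [tau [tau0 -> ttau]] := ess_sup_typicality.
move=> /= Mtau.
have tM x : S x -> t x <= M^-1.
  by move=> Sx; rewrite (le_trans (ttau _ Sx))// -[leLHS]invrK lef_pV2 ?posrE ?invr_gt0.
move=> x Sx; apply/eqP; rewrite eq_le tM//= leNgt; apply/negP => txM.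
have tx0 := t_gt0 Sx.
pose a := (t x + M^-1) / 2.
have xa : t x < a by rewrite /a; lra.
have aM : a < M^-1 by rewrite /a; lra.
have a0 : 0 < a by exact: lt_trans xa.
have Ma : M < a^-1 by rewrite -[ltLHS]invrK ltf_pV2 ?posrE ?invr_gt0.
pose U : set (borel X) := [set y | t y < a].
have oU : open (U : set X).
  rewrite (_ : U = t @^-1` [set z | z < a])//.
  by apply: open_comp => [y _|]; [exact: typicality_continuous|exact: open_lt].
have mU : measurable U by exact: open_measurable_borel.
have US : mu (U `&` S) != 0%E.
  apply/eqP => US0; apply: (open_null_supp oU _ Sx xa).
  have h := radon_suppC Xh (mu := mu) rmu.
  have mSC : measurable (~` S : set (borel X)) by exact: measurableC.
  have nU : mu.-negligible ((U `&` S) `|` ~` S).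
    apply: negligibleU; apply/negligibleP => //; exact: measurableI.
  apply/negligibleP => //; apply: negligibleS nU => y Uy.
  by have [Sy|nSy] := pselect (S y); [left|right].
have iU : mu.-integrable S (EFin \o \1_U).
  by apply: (@integrableS _ _ _ _ setT) => //; exact: integrable_indic.
have i1 : mu.-integrable S (EFin \o cst M) by exact: finite_measure_integrable_cst.
have i2 : mu.-integrable S (EFin \o (fun y => (a^-1 - M) * \1_U y)).
  exact: (integrableZl mS (a^-1 - M) iU).
have : \int[mu]_(y in S) (M + (a^-1 - M) * \1_U y) <= M.
  apply: le_Rintegral => //; first exact: (integrableD mS i1 i2).
    exact: powR_typicality_integrable.
  move=> y Sy; have ty := t_gt0 Sy; rewrite powR_inv1 ?(ltW ty)// indicE.
  case: (boolP (y \in U)) => [/set_mem Uy|_] /=.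
    by rewrite mulr1 addrC subrK lef_pV2 ?posrE// ltW.
  by rewrite mulr0 addr0 -[leLHS]invrK lef_pV2 ?posrE ?invr_gt0// tM.
rewrite RintegralD// RintegralZl// intS_cst gerDl.
rewrite pmulr_rle0 ?subr_gt0// /Rintegral integral_indic// => le0.
apply/negP: US; rewrite negbK; apply/eqP.
rewrite -[LHS]fineK ?fin_num_measure//; last exact: measurableI.
by congr EFin; apply/eqP; rewrite eq_le le0 fine_ge0.
Qed.

End diversity.

(** * Closed subspaces *)

Section scaled_pushforward.
Context d1 d2 (T1 : measurableType d1) (T2 : measurableType d2) (R : realType).
Variables (m : {finite_measure set T1 -> \bar R}) (f : T1 -> T2).
Hypothesis mf : measurable_fun [set: T1] f.
Variable k : {nonneg R}.

Definition scaled_pushforward : set T2 -> \bar R := mscale k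
  (measure_function_pushforward__canonical__measure_function_Measure m mf).

HB.instance Definition _ := Measure.on scaled_pushforward.

Let finite_scaled_pushforward : fin_num_fun scaled_pushforward.
Proof.
move=> A mA; rewrite /scaled_pushforward /mscale /pushforward fin_numM//.
by apply: fin_num_measure; rewrite -[X in measurable X]setTI; exact: mf.
Qed.

HB.instance Definition _ :=
  @Measure_isFinite.Build _ _ _ scaled_pushforward finite_scaled_pushforward.

End scaled_pushforward.

Lemma Rintegral_scaled_pushforward d1 d2 (T1 : measurableType d1)
    (T2 : measurableType d2) (R : realType)
    (m : {finite_measure set T1 -> \bar R}) (f : T1 -> T2)
    (mf : measurable_fun [set: T1] f) (k : {nonneg R}) (g : T2 -> R) :
  measurable_fun [set: T2] g -> (forall y, 0 <= g y) ->
  \int[scaled_pushforward m mf k]_y g y = k%:num * \int[m]_x g (f x).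
Proof.
move=> mg g0; rewrite /Rintegral.
have mgE : measurable_fun [set: T2] (fun y => (g y)%:E) by exact/measurable_EFinP.
rewrite ge0_integral_mscale//; last by move=> y _; rewrite lee_fin.
rewrite ge0_integral_pushforward//; last by move=> y _; rewrite lee_fin.
rewrite preimage_setT; case: (\int[m]_x _)%E => [r||] //=.
  by have [->|k0] := eqVneq k%:num 0; rewrite ?mul0e ?mul0r// mulr0
    gt0_muley// lte_fin lt_neqAle eq_sym k0/=.
by have [->|k0] := eqVneq k%:num 0; rewrite ?mul0e ?mul0r// mulr0
  gt0_muleNy// lte_fin lt_neqAle eq_sym k0/=.
Qed.

Section closed_subspace.
Context (X : ptopologicalType) (Y : set X) (Y0 : Y !=set0).
Local Notation sub := (@subsp X Y Y0).
Local Notation val := (@subsp_val X Y Y0).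

Lemma subsp_valP (y : sub) : Y (val y).
Proof. exact/set_mem/valP. Qed.

Lemma subsp_val_inj : injective val.
Proof. exact: val_inj. Qed.

Lemma subsp_val_continuous : continuous val.
Proof. exact: initial_continuous. Qed.

Lemma subsp_lift (x : X) : Y x -> exists y : sub, val y = x.
Proof. by move=> Yx; exists (SigSub (mem_set Yx)). Qed.

Lemma subsp_open (U : set sub) : open U -> exists2 V, open V & val @^-1` V = U.
Proof. by move=> [V oV VU]; exists V. Qed.

Lemma subsp_hausdorff : hausdorff_space X -> hausdorff_space sub.
Proof.
move=> Xh x y xy; apply: subsp_val_inj; apply: Xh => A B Ax By.
have [z [Az Bz]] := xy _ _ (subsp_val_continuous Ax) (subsp_val_continuous By).
by exists (val z).
Qed.

Lemma subsp_compact_preimage (C : set X) :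
  compact C -> C `<=` Y -> compact (val @^-1` C).
Proof.
move=> Cc CY F FF FC; have FF' : ProperFilter (val @ F) by exact: fmap_proper_filter.
have [x [Cx clx]] := Cc _ FF' FC.
have [y yx] := subsp_lift (CY _ Cx); exists y; split; first by rewrite /= yx.
move=> A B FA; rewrite nbhsE => -[U [/subsp_open[V oV VU] Uy] UB].
have [_ [[a Aa <-] Va]] : (val @` A) `&` V !=set0.
  apply: clx.
    by have : F (val @^-1` (val @` A)) by apply: filterS FA => a Aa /=; exists a.
  by apply: open_nbhs_nbhs; split => //; rewrite -yx; rewrite -VU in Uy.
by exists a; split => //; apply: UB; rewrite -VU.
Qed.

Lemma subsp_compact : compact Y -> compact [set: sub].
Proof.
move=> Yc; rewrite (_ : setT = val @^-1` Y); first exact: subsp_compact_preimage.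
by apply/seteqP; split => // y _; exact: subsp_valP.
Qed.

Lemma subsp_val_measurable :
  measurable_fun [set: borel sub] (val : borel sub -> borel X).
Proof.
apply: (@measurability _ _ (borel sub) (borel X) setT val (@open X) erefl).
move=> _ [U oU <-]; rewrite setTI.
by apply: open_measurable_borel; exists U.
Qed.

Definition retraction (x : X) : sub :=
  if pselect (Y x) is left Yx then SigSub (mem_set Yx) else point.

Lemma retractionK (x : X) : Y x -> val (retraction x) = x.
Proof. by rewrite /retraction; case: pselect. Qed.

Lemma retraction_measurable : closed Y ->
  measurable_fun [set: borel X] (retraction : borel X -> borel sub).
Proof.
move=> Yc.
apply: (@measurability _ _ (borel X) (borel sub) setT retraction (@open sub) erefl).
move=> _ [_ [V oV <-] <-].
rewrite setTI [X in measurable X](_ : _ = (Y `&` V) `|`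
    (~` Y `&` [set x | V (val point)])).
  have mY := closed_measurable_borel Yc.
  apply: measurableU; first by apply: measurableI => //; exact: open_measurable_borel.
  apply: measurableI; first exact: measurableC.
  have [Vp|nVp] := pselect (V (val point)).
    by rewrite (_ : mkset _ = setT)//; apply/seteqP; split.
  by rewrite (_ : mkset _ = set0)//; apply/seteqP; split.
apply/seteqP; split => x.
  change (V (val (retraction x)) -> (Y `&` V `|` ~` Y `&` [set x | V (val point)]) x).
  have [Yx|nYx] := pselect (Y x); first by rewrite retractionK//; left.
  by rewrite /retraction; case: pselect => // _ ?; right.
change ((Y `&` V `|` ~` Y `&` [set x | V (val point)]) x -> V (val (retraction x))).
move=> [[Yx Vx]|[nYx Vp]]; first by rewrite retractionK.
by rewrite /retraction; case: pselect.
Qed.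

End closed_subspace.

Section restriction.
Context (R : realType) (X : ptopologicalType) (K : X -> X -> R).
Hypothesis HK : space_with_similarities K.

Lemma restrict_kernel_sym (Y : set X) (Y0 : Y !=set0) : symmetric_kernel K ->
  symmetric_kernel (restrict_kernel K (Y0 := Y0)).
Proof. by move=> Ksym x y; exact: Ksym. Qed.

Lemma restrict_kernel_space (Y : set X) (Y0 : Y !=set0) : closed Y ->
  space_with_similarities (restrict_kernel K (Y0 := Y0)).
Proof.
move=> Yc; have [Xc Xh [Kc K0 Kx]] := HK; split.
- by apply: subsp_compact; exact: (subclosed_compact Yc Xc).
- exact: subsp_hausdorff.
split; [|by move=> x y; exact: K0|by move=> x; exact: Kx].
move=> p; apply: (@continuous_comp _ _ _
  (fun p : subsp Y0 * subsp Y0 => (subsp_val p.1, subsp_val p.2))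
  (fun p => K p.1 p.2)); last exact: Kc.
rewrite /continuous_at; apply: cvg_pair.
  by apply: (@continuous_comp _ _ _ fst (@subsp_val X Y Y0));
    [exact: cvg_fst|exact: subsp_val_continuous].
by apply: (@continuous_comp _ _ _ snd (@subsp_val X Y Y0));
  [exact: cvg_snd|exact: subsp_val_continuous].
Qed.

Lemma radon_setI_supp (mu : {finite_measure set (borel X) -> \bar R})
    (A : set (borel X)) : radon mu -> measurable A -> mu (A `&` supp mu) = mu A.
Proof.
move=> rmu mA; have [_ Xh _] := HK; have mS := measurable_supp mu.
have SC : mu (~` supp mu) = 0%E by exact: radon_suppC.
rewrite [RHS](measureDI _ mA mS).
rewrite [X in (X + _)%E](_ : _ = 0%E) ?add0e//.
have nSC : mu.-negligible (~` supp mu).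
  by apply/negligibleP => //; exact: measurableC.
apply/negligibleP; first exact: measurableD.
by apply: negligibleS nSC => x [].
Qed.

Lemma Rintegral_supp (mu : {finite_measure set (borel X) -> \bar R})
    (f : borel X -> R) : radon mu -> mu.-integrable [set: borel X] (EFin \o f) ->
  \int[mu]_x f x = \int[mu]_(x in supp mu) f x.
Proof.
move=> rmu fi; have [_ Xh _] := HK; have mS := measurable_supp mu.
rewrite /Rintegral (@negligible_integral _ _ _ mu setT (~` supp mu))//.
- by rewrite setTD setCK.
- exact: measurableC.
- exact: radon_suppC.
Qed.

Lemma balanced_weight (mu : probability (borel X) R) (c : R) : radon mu -> 0 < c ->
  (forall x, supp mu x -> typicality K mu x = c) ->
  exists (Y0 : supp mu !=set0) (nu : {charge set (borel (subsp Y0)) -> \bar R}),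
    [/\ positive_weight_measure (restrict_kernel K (Y0 := Y0)) nu,
        fine (nu [set: borel (subsp Y0)]) = c^-1
      & forall U : set (borel X), measurable U -> mu U = hat nu U].
Proof.
move=> rmu c0 muc; have [Xc Xh [Kc K0 Kx]] := HK.
have Sc : closed (supp mu) by exact: closed_supp.
have mS : measurable (supp mu : set (borel X)) by exact: closed_measurable_borel.
have muI (A : set (borel X)) : measurable A -> mu (A `&` supp mu) = mu A.
  by move=> mA; exact: (@radon_setI_supp mu A rmu mA).
have Y0 : supp mu !=set0.
  apply/set0P/eqP => S0; have := muI _ measurableT.
  rewrite S0 setI0 [LHS]measure0 => /esym; rewrite [LHS]probability_setT.
  by move/eqP; rewrite onee_eq0.
have mr := @retraction_measurable X (supp mu) Y0 Sc.
have ci0 : 0 <= c^-1 by rewrite invr_ge0 ltW.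
pose m : {finite_measure set (borel (subsp Y0)) -> \bar R} :=
  scaled_pushforward mu mr (NngNum ci0).
have mE A : m A = ((c^-1)%:E * mu (retraction Y0 @^-1` A))%E by [].
have mpre (A : set (borel (subsp Y0))) : measurable A ->
    measurable (retraction Y0 @^-1` A : set (borel X)).
  by move=> mA; rewrite -[X in measurable X]setTI; exact: (mr measurableT A mA).
have HKY := restrict_kernel_space Y0 Sc.
have [Yc Yh _] := HKY.
have rm : radon m.
  apply: approx_radon => // A e mA e0.
  have mB : measurable ((retraction Y0 @^-1` A) `&` supp mu : set (borel X)).
    by apply: measurableI => //; exact: mpre.
  have ec0 : 0 < e * c by rewrite mulr_gt0.
  have [C [Cc CB muB]] := @radon_approx R X mu _ _ rmu mB ec0.
  exists (@subsp_val X _ Y0 @^-1` C); split.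
  - by apply: subsp_compact_preimage => // x /CB[].
  - move=> y /= /CB[/= + _]; congr A.
    by apply: subsp_val_inj; rewrite retractionK//; exact: subsp_valP.
  have -> : (m A = (c^-1)%:E * mu (retraction Y0 @^-1` A `&` supp mu))%E.
    by rewrite mE muI//; exact: mpre.
  have mC : measurable (C : set (borel X)) by exact: compact_borel Cc.
  have mC' : measurable (@subsp_val X _ Y0 @^-1` C : set (borel (subsp Y0))).
    by rewrite -[X in measurable X]setTI; exact: subsp_val_measurable.
  have muC : (mu C <= mu (retraction Y0 @^-1` (@subsp_val X _ Y0 @^-1` C)))%E.
    apply: le_measure; rewrite ?inE//; first exact: mpre.
    by move=> x Cx /=; rewrite retractionK//; have [] := CB _ Cx.
  have := le_trans muB (leeD2r (e * c)%:E muC).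
  rewrite -(@lee_pmul2l _ (c^-1)%:E)// ?lte_fin ?invr_gt0// => h.
  rewrite (le_trans h)// mE muleDr//; last first.
    by rewrite ge0_adde_def// inE// lee_fin mulr_ge0// ltW.
  by rewrite -EFinM mulrCA mulVf ?gt_eqF// mulr1.
have Km y : typicality (restrict_kernel K (Y0 := Y0)) m y = 1.
  rewrite /typicality Rintegral_scaled_pushforward//=.
  - rewrite -[RHS](mulVf (x := c)) ?gt_eqF//; congr (_ * _).
    rewrite -(muc (subsp_val y)); last exact: subsp_valP.
    have Ki := kernel_integrable HK mu (subsp_val y).
    have mK := kernel_measurable HK (subsp_val y).
    have [M KM] := continuous_bounded HK (kernel_continuousr HK (x := subsp_val y)).
    rewrite /typicality !Rintegral_supp//.
      by apply: eq_Rintegral => x /set_mem Sx; rewrite /restrict_kernel retractionK.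
    apply: (@bounded_integrable _ _ _ _ _ _ M) => //.
      exact: (measurableT_comp (kernel_measurable HKY y) (mr)).
    by move=> x _; exact: KM.
  - exact: (kernel_measurable HKY y).
  - by move=> z; exact: K0.
have mT : m [set: borel (subsp Y0)] = (c^-1)%:E.
  by rewrite mE preimage_setT [X in (_ * X)%E](@probability_setT _ _ _ mu) mule1.
have [nu wnu nuE] := finite_measure_weight Yh rm Km.
exists Y0, nu; split => //.
  by rewrite nuE// mT.
move=> U mU; rewrite /hat !nuE//; last first.
  by rewrite -[X in measurable X]setTI; exact: subsp_val_measurable.
have mrU : measurable (retraction Y0 @^-1` (@subsp_val X _ Y0 @^-1` U) : set (borel X)).
  by apply: mpre; rewrite -[X in measurable X]setTI; exact: subsp_val_measurable.
rewrite mT mE invrK.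
rewrite muleAC -EFinM mulVf ?gt_eqF// mul1e -muI// -[RHS]muI//; congr (mu _).
apply/seteqP; split => x /= [Ux Sx]; split => //; first by rewrite retractionK.
by rewrite retractionK in Ux.
Qed.

End restriction.

Lemma probability_of_measure d (T : measurableType d) (R : realType)
    (m : {measure set T -> \bar R}) : m [set: T] = 1%E ->
  exists P : probability T R, forall A, P A = m A.
Proof.
move=> m1; exists (mnormalize m (dirac point)) => A.
by rewrite /= /mnormalize m1 onee_eq0/= invr1 mule1.
Qed.

Section normalised_weights.
Context (R : realType) (X : ptopologicalType) (K : X -> X -> R).
Hypotheses (HK : space_with_similarities K) (Ksym : symmetric_kernel K).
Context (Y : set X) (Y0 : Y !=set0) (Yc : closed Y).
Variable nu : {charge set (borel (subsp Y0)) -> \bar R}.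
Hypothesis wnu : positive_weight_measure (restrict_kernel K (Y0 := Y0)) nu.

Let KY := restrict_kernel K (Y0 := Y0).
Let val := @subsp_val X Y Y0.
Let m := jordan_pos (hahn_of nu).
Let M := fine (nu [set: borel (subsp Y0)]).

Let HKY : space_with_similarities KY. Proof. exact: restrict_kernel_space. Qed.

Let mE A : measurable A -> m A = nu A.
Proof. by move=> mA; apply: jordan_pos_nonneg => //; case: wnu. Qed.

Let Km y : typicality KY m y = 1.
Proof.
have [[_ Knu] nu0] := wnu; rewrite -(Knu y).
by apply/esym/charge_typicality_nonneg => // A mA; exact: mE.
Qed.

Let MmE : nu [set: borel (subsp Y0)] = M%:E.
Proof. by rewrite fineK// fin_num_measure. Qed.

Lemma weight_mass_gt0 : 0 < M.
Proof.
rewrite lt_neqAle; apply/andP; split; last first.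
  by rewrite fine_ge0//; have [_ nu0] := wnu; exact: nu0.
apply/eqP => M0.
have [B KB] := continuous_bounded HKY (kernel_continuousr HKY (x := point)).
have := Km point; apply/eqP; rewrite lt_eqF//.
apply: (@le_lt_trans _ _ (\int[m]_x cst B x)); last first.
  rewrite Rintegral_cst// [X in fine X](_ : _ = 0%E) ?mulr0//.
  by rewrite [LHS](mE measurableT) MmE -M0.
apply: le_Rintegral => //; first exact: kernel_integrable.
  exact: finite_measure_integrable_cst.
by move=> x _; rewrite (le_trans (ler_norm _))// KB.
Qed.

Lemma magnitude_weight : magnitude KY = M.
Proof. by apply: magnitudeE => //; exact: restrict_kernel_sym. Qed.

Lemma hat_probability : exists2 P : probability (borel X) R, radon P &
  forall U : set (borel X), measurable U -> P U = hat nu U.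
Proof.
have M0 := weight_mass_gt0; have [Xc Xh _] := HK; have [_ Yh _] := HKY.
have Mi0 : 0 <= M^-1 by rewrite invr_ge0 ltW.
have mval := @subsp_val_measurable X Y Y0.
pose m' : {finite_measure set (borel X) -> \bar R} :=
  scaled_pushforward m mval (NngNum Mi0).
have m'E A : m' A = ((M^-1)%:E * m (val @^-1` A))%E by [].
have mpre (A : set (borel X)) : measurable A ->
    measurable (val @^-1` A : set (borel (subsp Y0))).
  by move=> mA; rewrite -[X in measurable X]setTI; exact: (mval measurableT A mA).
have m'1 : m' [set: borel X] = 1%E.
  by rewrite m'E preimage_setT (mE measurableT) MmE -EFinM mulVf ?gt_eqF.
have [P PE] := @probability_of_measure _ _ _ m' m'1.
have {}PE A : P A = ((M^-1)%:E * m (val @^-1` A))%E by exact: PE.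
exists P; last first.
  by move=> U mU; rewrite PE (mE (mpre _ mU)) /hat muleC.
have [[rnu _] nu0] := wnu.
have rm : radon m.
  apply: (eq_radon Yh _ rnu) => A mA.
  by rewrite mE// charge_variation_nonneg.
apply: (@approx_radon R X Xh P) => A e mA e0.
have eM0 : 0 < e * M by rewrite mulr_gt0.
have [C [Cc CA mC]] := @radon_approx R (subsp Y0) m _ _ rm (mpre _ mA) eM0.
have C'c : compact (val @` C).
  apply: continuous_compact => //; apply: continuous_subspaceT.
  exact: subsp_val_continuous.
exists (val @` C); split => //; first by move=> _ [y /CA Ay <-].
rewrite [leLHS]PE [X in (_ <= X + _)%E]PE (_ : val @^-1` (val @` C) = C); last first.
  by apply/seteqP; split => [y [z Cz /subsp_val_inj <-]//|y Cy]; exists y.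
move: mC; rewrite -(@lee_pmul2l _ (M^-1)%:E)// ?lte_fin ?invr_gt0// => h.
rewrite (le_trans h)// muleDr//; last first.
  by rewrite ge0_adde_def// inE// lee_fin mulr_ge0// ltW.
by rewrite -EFinM mulrCA mulVf ?gt_eqF// mulr1.
Qed.

Variable P : probability (borel X) R.
Hypotheses (rP : radon P).
Hypothesis PE : forall U : set (borel X), measurable U -> P U = hat nu U.

Lemma hat_supp : supp P `<=` Y.
Proof.
rewrite -[Y]setCK; apply: (@open_null_supp _ _ P); first exact: closed_openC.
rewrite [LHS]PE; last by apply: measurableC; exact: closed_measurable_borel.
rewrite /hat (_ : _ @^-1` _ = set0) ?charge0 ?mul0e//.
by apply/seteqP; split => // y; apply; exact: subsp_valP.
Qed.

Lemma hat_typicality x : Y x -> typicality K P x = M^-1.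
Proof.
move=> /(@subsp_lift X Y Y0)[y <-].
have M0 := weight_mass_gt0; have [_ _ [_ K0 _]] := HK.
have Mi0 : 0 <= M^-1 by rewrite invr_ge0 ltW.
have mval := @subsp_val_measurable X Y Y0.
rewrite /typicality /Rintegral
  (eq_measure_integral (scaled_pushforward m mval (NngNum Mi0))); last first.
  move=> A mA _; rewrite [LHS]PE// /hat muleC; congr (_ * _)%E.
  by apply/esym/mE; rewrite -[X in measurable X]setTI; exact: (mval measurableT A mA).
rewrite [LHS]Rintegral_scaled_pushforward//=.
  by rewrite [X in _ * X](Km y) mulr1.
exact: (kernel_measurable HK).
Qed.

Lemma hat_diversity (q : \bar R) : (0 <= q)%E -> diversity K q P = magnitude KY.
Proof.
move=> q0; rewrite magnitude_weight -[RHS]invrK.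
apply: diversity_balanced => //; first by rewrite invr_gt0 weight_mass_gt0.
by move=> x /hat_supp; exact: hat_typicality.
Qed.

End normalised_weights.

Lemma weighted_diracs (R : realType) (X : ptopologicalType) (K : X -> X -> R)
    (n : nat) (s : 'I_n -> X) (w : 'I_n -> R) :
    space_with_similarities K -> prob_vec w ->
  exists P : probability (borel X) R, [/\ radon P,
    supp P `<=` [set s i | i in [set i | 0 < w i]] &
    forall x, typicality K P x = \sum_i K x (s i) * w i].
Proof.
move=> HK [w0 w1]; have [Xc Xh [_ K0 _]] := HK.
case: n s w w0 w1 => [|n] s w w0 w1.
  by move: w1; rewrite big_ord0 => /eqP; rewrite eq_sym oner_eq0.
pose mk (k : nat) : {measure set (borel X) -> \bar R} :=
  mscale (NngNum (w0 (inord k))) (dirac (s (inord k) : borel X)).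
pose m : {measure set (borel X) -> \bar R} := msum mk n.+1.
have mE A : m A = (\sum_i (w i)%:E * (\d_(s i : borel X)) A)%E.
  by apply: eq_bigr => i _; rewrite /mk /mscale/= inord_val.
have [|P PE] := @probability_of_measure _ _ _ m.
  rewrite mE; under eq_bigr do rewrite diracT mule1.
  by rewrite sumEFin w1.
have finC (I : set 'I_n.+1) : compact (s @` I).
  by apply: finite_compact; exact: finite_image.
have null (A : set (borel X)) : (forall i, 0 < w i -> ~ A (s i)) -> P A = 0%E.
  move=> Aw; rewrite PE mE big1// => i _.
  have [wi|] := ltP 0 (w i); last first.
    by move=> wi; rewrite (_ : w i = 0) ?mul0e//; apply/eqP; rewrite eq_le wi w0.
  by rewrite diracE memNset ?mule0//; exact: Aw.
exists P; split.
- apply: (@approx_radon R X Xh P) => A e mA e0.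
  pose C := s @` [set i | A (s i)]; exists C; split.
  + exact: finC.
  + by move=> _ [i Ai <-].
  have PAC : P A = P C.
    rewrite !PE !mE; apply: eq_bigr => i _; congr (_ * _)%E; rewrite !diracE.
    congr (_%:R%:E); have [Ai|nAi] := pselect (A (s i)).
      by rewrite !mem_set//; exists i.
    by rewrite !memNset// => -[j Aj ji]; apply: nAi; rewrite -ji.
  by rewrite [leLHS]PAC; apply: leeDl; rewrite lee_fin ltW.
- rewrite -[X in _ `<=` X]setCK; apply: (@open_null_supp _ _ P).
    by apply: closed_openC; apply: compact_closed.
  by apply: null => i wi; apply; exists i.
move=> x; rewrite /typicality /Rintegral (eq_measure_integral m); last first.
  by move=> A mA _; exact: PE.
have mK : measurable_fun [set: borel X] (fun y => (K x y)%:E).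
  by apply/measurable_EFinP; exact: kernel_measurable.
rewrite ge0_integral_measure_sum//; last by move=> y _; rewrite lee_fin.
rewrite (eq_bigr (fun i : 'I_n.+1 => (K x (s i) * w i)%:E)) ?sumEFin//.
move=> i _; rewrite ge0_integral_mscale//; last by move=> y _; rewrite lee_fin.
by rewrite integral_dirac// diracT mul1e/= inord_val -EFinM mulrC.
Qed.

(** * Maximum diversity *)

Section maximum_diversity.
Context (R : realType) (X : ptopologicalType) (K : X -> X -> R).
Hypotheses (HK : space_with_similarities K) (Ksym : symmetric_kernel K).
Implicit Types mu : probability (borel X) R.

Lemma balanced_le_sup mu (c : R) : radon mu -> 0 < c ->
  (forall x, supp mu x -> typicality K mu x = c) ->
  ((c^-1)%:E <= sup_magnitude K)%E.
Proof.
move=> rmu c0 muc; have [Y0 [nu [wnu nuT _]]] := balanced_weight HK rmu c0 muc.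
have Sc : closed (supp mu) by exact: closed_supp.
apply: ereal_sup_ubound; exists (supp mu), Y0; split => //; first by exists nu.
by rewrite (magnitude_weight HK Ksym Sc wnu) nuT.
Qed.

(* Replacing mu by its masses on a fine Borel partition costs at most a factor
   [1 + eta]; a balanced measure on the finite net then does at least as well. *)
Lemma diversity0_approx mu (eta : R) : radon mu -> 0 < eta < 1 ->
  ((diversity K 0%E mu / (1 + eta))%:E <= sup_magnitude K)%E.
Proof.
move=> rmu /andP[eta0 eta1]; have [Xc Xh [Kc K0 Kx]] := HK.
have [b b0 bt] := typicality_supp_lb HK mu.
have e0 : 0 < b * eta / 2 by rewrite divr_gt0// mulr_gt0.
have [n [s [phi [mphi sphi]]]] := finite_net HK e0.
set e := b * eta / 2 in e0 sphi.
pose p i := fine (mu (phi @^-1` [set i])).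
pose T := typ_vec (fun i j => K (s i) (s j)) p.
have muT1 : fine (mu [set: borel X]) = 1.
  by rewrite [X in fine X](@probability_setT _ _ _ mu).
have pp : prob_vec p.
  split; first by move=> i; exact: fine_ge0.
  have [_] := Rintegral_finite_range mu (cst 1) mphi.
  rewrite Rintegral_cst// muT1 mul1r => ->.
  by apply: eq_bigr => i _; rewrite mul1r.
have tT x : `|typicality K mu x - T (phi x)| <= b * eta.
  have h1 := typicality_close HK mu (fun y => ltW (sphi x y)).
  have h2 := typicality_net HK Ksym mphi sphi mu (s (phi x)).
  rewrite (_ : \sum_i _ = T (phi x)) in h2; last first.
    by apply: eq_bigr => i _; rewrite [in RHS]Ksym.
  rewrite !muT1 mulr1 in h1 h2.
  rewrite (_ : _ - T _ = (typicality K mu x - typicality K mu (s (phi x))) +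
    (typicality K mu (s (phi x)) - T (phi x))); last by ring.
  rewrite (le_trans (ler_normD _ _))// (le_trans (lerD h1 h2))//.
  by rewrite /e; lra.
have mS : measurable (supp mu : set (borel X)) by exact: measurable_supp.
pose F i := (1 + eta) / T i.
have [mF intF] := Rintegral_finite_range mu F mphi.
have T0 i : 0 <= T i.
  by apply: sumr_ge0 => j _; rewrite mulr_ge0// fine_ge0.
have F0 i : 0 <= F i by rewrite divr_ge0// addr_ge0// ltW.
have iF : mu.-integrable [set: borel X] (EFin \o (F \o phi)).
  apply: (@bounded_integrable _ _ _ mu _ _ (\sum_i F i)) => // x _ /=.
  by rewrite ger0_norm// (bigD1 (phi x))//= lerDl sumr_ge0.
have DF : diversity K 0%E mu <= (1 + eta) * \sum_i p i / T i.
  rewrite mulr_sumr [leRHS](_ : _ = \int[mu]_x (F \o phi) x); last first.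
    by rewrite intF; apply: eq_bigr => i _; rewrite /F -/(p i); ring.
  rewrite (Rintegral_supp HK (mu := mu) rmu iF) diversity0E//.
  apply: le_Rintegral => //.
  - exact: powR_typicality_integrable.
  - by apply: integrableS iF.
  move=> x Sx /=; have t0 := typicality_supp_gt0 HK Sx.
  rewrite powR_inv1 ?(ltW t0)//.
  have bx := bt _ Sx; have := tT x; rewrite ler_norml => /andP[l1 l2].
  have be : b * eta <= eta * typicality K mu x by rewrite mulrC ler_pM2l.
  have Tx : 0 < T (phi x).
    have : eta * typicality K mu x < typicality K mu x by rewrite gtr_pMl.
    lra.
  by rewrite /F -div1r ler_pdivrMr// -mulrAC ler_pdivlMr//; lra.
have [w [c [ww c0 wc pc]]] := @balanced_vec _ _ (fun i j => K (s i) (s j))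
  (fun i j => Ksym _ _) (fun i j => K0 _ _) (fun i => Kx _) p pp.
have [P [rP SP KP]] := weighted_diracs s HK ww.
apply: le_trans (balanced_le_sup rP c0 _).
  by rewrite lee_fin ler_pdivrMr ?addr_gt0// mulrC (le_trans DF)// ler_wpM2l// addr_ge0// ltW.
by move=> x /SP[i wi <-]; rewrite KP -(wc i).
Qed.

Lemma diversity_le_sup mu (q : \bar R) : radon mu -> (0 <= q)%E ->
  ((diversity K q mu)%:E <= sup_magnitude K)%E.
Proof.
move=> rmu q0; apply: (@le_trans _ _ (diversity K 0%E mu)%:E).
  by rewrite lee_fin diversity_le0.
have D0 : 0 < diversity K 0%E mu by rewrite diversity0E// diversity0_gt0.
apply/lee_addgt0Pr => e e0; set D := diversity K 0%E mu in D0 *.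
have De0 : 0 < D + e by rewrite addr_gt0.
have eta01 : 0 < e / (D + e) < 1.
  by rewrite divr_gt0//= ltr_pdivrMr// mul1r ltrDr.
have := diversity0_approx rmu eta01; rewrite -/D => h.
apply: (le_trans _ (leeD2r _ h)); rewrite -EFinD lee_fin.
have u0 : 0 < 1 + e / (D + e) by case/andP: eta01 => ? _; rewrite addr_gt0.
rewrite -lerBlDr ler_pdivlMr// -subr_ge0.
rewrite (_ : _ - _ = e ^+ 2 * 2 / (D + e)); last by field; rewrite gt_eqF.
by rewrite divr_ge0 ?mulr_ge0 ?sqr_ge0// ltW.
Qed.

Lemma max_diversityE (q : \bar R) : (0 <= q)%E ->
  max_diversity K q = sup_magnitude K.
Proof.
move=> q0; apply/eqP; rewrite eq_le; apply/andP; split.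
  by apply: ge_ereal_sup => _ [mu rmu <-]; exact: diversity_le_sup.
apply: ge_ereal_sup => _ [Y [Y0 [Yc [nu wnu] ->]]].
have [P rP PE] := hat_probability HK Yc wnu.
apply: ereal_sup_ubound; exists P => //.
by rewrite (hat_diversity HK Ksym Yc wnu rP PE q0).
Qed.

Lemma maximisingP mu : radon mu ->
  maximising K mu <->
  forall q : \bar R, (0 <= q)%E -> (diversity K q mu)%:E = sup_magnitude K.
Proof.
move=> rmu; split=> [[_ mmax] q q0|muq].
  apply/eqP; rewrite eq_le diversity_le_sup//= -(max_diversityE q0).
  by apply: ge_ereal_sup => _ [mu' rmu' <-]; rewrite lee_fin mmax.
split=> // q q0 mu' rmu'; rewrite -lee_fin muq//.
exact: diversity_le_sup.
Qed.

End maximum_diversity.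

Theorem corollary7p4 (R : realType) (X : ptopologicalType) (K : X -> X -> R)
    (HK : space_with_similarities K) (Ksym : symmetric_kernel K)
    (q : \bar R) (q_ge0 : (0 <= q)%E) :
  max_diversity K q = sup_magnitude K
  /\
  forall mu : probability (borel X) R, radon mu ->
    (maximising K mu <->
      exists (Y : set X) (Y0 : Y !=set0)
             (nu : {charge set (borel (subsp Y0)) -> \bar R}),
        [/\ closed Y,
            positive_weight_measure (restrict_kernel K (Y0 := Y0)) nu,
            (magnitude (restrict_kernel K (Y0 := Y0)))%:E = max_diversity K q
          & forall U : set (borel X), measurable U -> mu U = hat nu U])
    /\
    (maximising K mu ->
      exists Y0 : supp mu !=set0,
        admits_weight_measure (restrict_kernel K (Y0 := Y0)) /\
        max_diversity K q = (magnitude (restrict_kernel K (Y0 := Y0)))%:E).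
Proof.
split; first exact: max_diversityE.
move=> mu rmu; rewrite max_diversityE//.
have Sc : closed (supp mu) by have [_ Xh _] := HK; exact: closed_supp.
have suppW : maximising K mu -> exists (Y0 : supp mu !=set0)
    (nu : {charge set (borel (subsp Y0)) -> \bar R}),
    [/\ positive_weight_measure (restrict_kernel K (Y0 := Y0)) nu,
        (magnitude (restrict_kernel K (Y0 := Y0)))%:E = sup_magnitude K
      & forall U : set (borel X), measurable U -> mu U = hat nu U].
  move=> /(maximisingP HK Ksym rmu) muq.
  have D0 : 0 < diversity K 0%E mu by rewrite diversity0E// diversity0_gt0.
  have D0y : diversity K 0%E mu <= diversity K +oo%E mu.
    by rewrite -lee_fin !muq.
  have bal := balanced_of_diversity_le HK rmu D0y.
  have Di0 : 0 < (diversity K 0%E mu)^-1 by rewrite invr_gt0.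
  have [Y0 [nu [wnu nuT muE]]] := balanced_weight HK rmu Di0 bal.
  exists Y0, nu; split => //.
  by rewrite (magnitude_weight HK Ksym Sc wnu) nuT invrK muq.
split; last first.
  by move=> /suppW[Y0 [nu [wnu mE _]]]; exists Y0; split => //; exists nu; case: wnu.
split=> [/suppW[Y0 [nu [wnu mE muE]]]|[Y [Y0 [nu [Yc wnu mE muE]]]]].
  by exists (supp mu), Y0, nu.
apply/(maximisingP HK Ksym rmu) => q' q'0.
by rewrite (hat_diversity HK Ksym Yc wnu rmu muE q'0).
Qed.
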